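(* Let $P_8$ and $\tilde P_8$ be the eighth terms of the $\mathrm{SO}$-Bott chain (starting with $\mathrm{SO}_{16n}$) and of the $\mathrm{U}$-Bott chain (starting with $\mathrm{U}_{16n}$), constructed with the same base points, so that $P_8\subset\tilde P_8$. Then there exists an isometry $\psi:\tilde P_8\to\mathrm{U}_n$ which maps $P_8$ to $\mathrm{SO}_n$ and makes the diagram $$\begin{array}{ccc}P_8&\xrightarrow{\ \psi|_{P_8}\ }&\mathrm{SO}_n\\ \cap&&\cap\\ \tilde P_8&\xrightarrow{\ \ \psi\ \ }&\mathrm{U}_n\end{array}$$ commutative, where $\mathrm{SO}_n\subset\mathrm{U}_n$ is the standard inclusion (real matrices regarded as complex matrices).
   Context: Centrioles. For a compact connected Riemannian symmetric space $P$ let $s_x$ be the geodesic symmetry at $x$. For $o\in P$, a pole of $(P,o)$ is a point $p\ne o$ with $s_p=s_o$. If $p$ is a pole, the centrosome $C_p(P,o)$ is the set of midpoints of geodesics in $P$ from $o$ to $p$; its connected components are the centrioles of $(P,o)$ relative to $p$. A centriole containing a midpoint of a shortest geodesic segment from $o$ to $p$ is called an s-centriole. $\mathrm{SO}$-Bott chain. $n\ge1$ is an integer, $P_0=\mathrm{SO}_{16n}$ with the bi-invariant metric $\langle X,Y\rangle=-\mathrm{tr}(XY)$, $J_0=I$. $P_1$ is one of the two connected components of $\{J\in\mathrm{SO}_{16n}: J^2=-I\}$; inductively, having picked $J_k\in P_k$ ($1\le k\le 7$), $P_{k+1}$ is the top-dimensional connected component of $\{J\in P_k: JJ_k=-J_kJ\}$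 (for $k=7$: any one of the two components, which are diffeomorphic). $\mathrm{U}$-Bott chain. $\tilde P_0=\mathrm{U}_{16n}$ with the bi-invariant metric $\langle X,Y\rangle=-\mathrm{tr}(XY)$; for $0\le k\le7$, $\tilde P_{k+1}$ is the top-dimensional s-centriole of $(\tilde P_k,J_k)$ relative to the pole $-J_k$, with the base points $J_k$ of the $\mathrm{SO}$-chain (one has $P_k\subset\tilde P_k$ for all $k$, so this makes sense). Metrics. $\tilde P_8$ carries the submanifold metric from $\mathrm{U}_{16n}$; $\mathrm{U}_n$ carries the bi-invariant metric induced by $\langle X,Y\rangle=-16\,\mathrm{tr}(XY)$, $X,Y\in\mathfrak u_n$. *)

(* Defs.v *)
From HB Require Import structures.
From mathcomp Require Import all_boot all_order all_algebra.
From mathcomp Require Import all_classical all_reals all_analysis.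
From mathcomp Require Import complex.

Set Implicit Arguments.
Unset Strict Implicit.
Unset Printing Implicit Defensive.

Import Order.TTheory GRing.Theory Num.Theory.
Import numFieldNormedType.Exports.

Local Open Scope classical_set_scope.
Local Open Scope ring_scope.
Local Open Scope sesquilinear_scope.

(* Submanifolds are subsets of a finite-dimensional real normed space V. *)

Section Submanifolds.
Variable R : realType.
Implicit Types V W : normedModType R.

Definition is_component V (A C : set V) : Prop :=
  exists2 x, A x & C = connected_component A x.

Definition smooth_curve V (S : set V) (c : R -> V) : Prop :=
  (forall t, S (c t)) /\ (forall k t, derivable (derive1n k c) t 1).

(* Velocities of the smooth curves of S through x: the usual tangent space
   when S is an embedded submanifold. *)
Definition tangent V (S : set V) (x : V) : set V :=
  [set v | exists c, [/\ smooth_curve S c, c 0 = x & derive1 c 0 = v]].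

Definition has_dim V (S : set V) (d : nat) : Prop :=
  forall x, S x -> exists b : 'I_d -> V,
    [/\ forall i, tangent S x (b i),
        forall a : 'I_d -> R, \sum_i a i *: b i = 0 -> forall i, a i = 0 &
        forall v, tangent S x v -> exists a : 'I_d -> R, v = \sum_i a i *: b i].

(* C has maximal dimension among the members of the family F. *)
Definition top_dim V (F : set (set V)) (C : set V) : Prop :=
  F C /\ exists2 d, has_dim C d &
    forall D e, F D -> has_dim D e -> (e <= d)%N.

(* Iterated directional derivatives exist to all orders and are continuous. *)
Definition smooth_on_open V W (U : set V) (F : V -> W) : Prop :=
  forall (vs : seq V) (x : V), U x ->
    let G := foldr (fun v H => 'D_v H) F vs in
    (forall v, derivable G x v) /\ {for x, continuous G}.

(* Smoothness on a submanifold: local extendability to a smooth map. *)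
Definition smooth_on V W (S : set V) (f : V -> W) : Prop :=
  forall x, S x -> exists (U : set V) (F : V -> W),
    [/\ open U, U x, smooth_on_open U F & forall y, S y -> U y -> F y = f y].

(* g x v w is the scalar product of the tangent vectors v, w at x.  In the
   last clause derive1 (f \o a) 0 is the differential of f at x applied to the
   velocity derive1 a 0. *)
Definition riem_isometry V W (g : V -> V -> V -> R) (h : W -> W -> W -> R)
    (S : set V) (T : set W) (f : V -> W) : Prop :=
  [/\ set_bij S T f,
      smooth_on S f,
      exists2 f' : W -> V, smooth_on T f' & forall x, S x -> f' (f x) = x &
      forall x (a b : R -> V), smooth_curve S a -> smooth_curve S b ->
        a 0 = x -> b 0 = x ->
        h (f x) (derive1 (f \o a) 0) (derive1 (f \o b) 0)
          = g x (derive1 a 0) (derive1 b 0)].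

End Submanifolds.

(* A complex matrix A + iB is stored as the pair (A, B): this is a real normed
   space, whereas 'M[R[i]]_N only carries the structure of a normed space over
   R[i]. *)
Notation cmat R N := ('M[R]_N * 'M[R]_N)%type.

Section Matrices.
Variables (R : realType) (N : nat).

Definition toC (z : cmat R N) : 'M[R[i]]_N :=
  \matrix_(j, k) (z.1 j k +i* z.2 j k)%C.

Definition emb (A : 'M[R]_N) : cmat R N := (A, 0).

Definition SO : set 'M[R]_N := [set A | A *m A^T = 1%:M /\ \det A = 1].

Definition Ugrp : set (cmat R N) := [set z | toC z \is unitarymx].

(* The bi-invariant metric on Ugrp that is - c tr(XY) at the identity.  The
   trace is real on tangent vectors, so that taking the real part only serves
   to land in R. *)
Definition biinv (c : R) (g X Y : cmat R N) : R :=
  - c * complex.Re (\tr (invmx (toC g) *m toC X *m (invmx (toC g) *m toC Y))).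

Definition dotmx (X Y : cmat R N) : R :=
  \tr (X.1 *m Y.1^T) + \tr (X.2 *m Y.2^T).

End Matrices.

Arguments SO R N : clear implicits.
Arguments Ugrp R N : clear implicits.

(* On Ugrp the bi-invariant metric is the restriction of the Euclidean scalar
   product: the tangent vectors Y at g are those with g^-1 Y skew-Hermitian. *)
Lemma biinv_dotmx (R : realType) (N : nat) (c : R) (g X Y : cmat R N) :
  Ugrp R N g ->
  (invmx (toC g) *m toC Y)^t* = - (invmx (toC g) *m toC Y) ->
  biinv c g X Y = c * dotmx X Y.
Proof.
set G := toC g; set A := invmx G *m toC X; set B := invmx G *m toC Y.
move=> gU; have {gU} GU : G \is unitarymx := gU.
move=> BE; rewrite /biinv -/G -/A -/B.
have -> : A *m B = - (A *m B^t*) by rewrite BE mulmxN opprK.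
rewrite !raddfN /= mulrNN; congr (_ * _).
rewrite /B trmx_mul map_mxM mulmxA mxtrace_mulC /A !mulmxA (invmx_unitary GU).
rewrite trmxCK (unitarymxP GU) mul1mx /dotmx.
rewrite /mxtrace raddf_sum -big_split; apply: eq_bigr => j _.
rewrite !mxE raddf_sum -big_split; apply: eq_bigr => k _.
by rewrite !mxE /= mulrN opprK.
Qed.

Section SymmetricSpaces.
Variables (R : realType) (N : nat).
Implicit Types (P C : set (cmat R N)) (o p x : cmat R N).

(* Geodesics, defined on all of R, of a submanifold P of Ugrp with the induced
   metric.  By biinv_dotmx this is the metric induced by dotmx, so the covariant
   derivative of the velocity is the tangential part of the second derivative. *)
Definition geodesic P (c : R -> cmat R N) : Prop :=
  smooth_curve P c /\
  forall t w, tangent P (c t) w -> dotmx (derive1n 2 c t) w = 0.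

(* Geodesic segments are parametrized by [0, 1]. *)
Definition geodesic_from_to P o p (c : R -> cmat R N) : Prop :=
  [/\ geodesic P c, c 0 = o & c 1 = p].

Definition arc_length (c : R -> cmat R N) : R :=
  \int[lebesgue_measure]_(t in `[0, 1])
    Num.sqrt (biinv 1 (c t) (derive1 c t) (derive1 c t)).

Definition shortest_geodesic P o p (c : R -> cmat R N) : Prop :=
  geodesic_from_to P o p c /\
  forall c', geodesic_from_to P o p c' -> arc_length c <= arc_length c'.

Definition geodesic_symmetry P x (s : cmat R N -> cmat R N) : Prop :=
  riem_isometry (biinv 1) (biinv 1) P P s /\
  forall c, geodesic P c -> c 0 = x -> forall t, s (c t) = c (- t).

Definition pole P o p : Prop :=
  [/\ P o, P p, p <> o &
      exists2 s, geodesic_symmetry P o s & geodesic_symmetry P p s].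

Definition centrosome P o p : set (cmat R N) :=
  [set x | exists2 c, geodesic_from_to P o p c & c 2^-1 = x].

Definition centriole P o p C : Prop :=
  pole P o p /\ is_component (centrosome P o p) C.

Definition s_centriole P o p C : Prop :=
  centriole P o p C /\ exists2 c, shortest_geodesic P o p c & C (c 2^-1).

End SymmetricSpaces.

Section BottChains.
Variables (R : realType) (n : nat).

(* Only the terms J k with k <= 7 and P k, Pt k with k <= 8 are constrained. *)
Definition SO_Bott_chain (J : nat -> 'M[R]_(16 * n))
    (P : nat -> set 'M[R]_(16 * n)) : Prop :=
  [/\ P 0%N = SO R (16 * n) /\ J 0%N = 1%:M,
      is_component [set A | SO R (16 * n) A /\ A *m A = - 1%:M] (P 1%N),
      forall k, (1 <= k <= 7)%N -> P k (J k) &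
      forall k, (1 <= k <= 7)%N ->
        top_dim (is_component [set A | P k A /\ A *m J k = - (J k *m A)])
                (P k.+1)].

Definition U_Bott_chain (J : nat -> 'M[R]_(16 * n))
    (Pt : nat -> set (cmat R (16 * n))) : Prop :=
  Pt 0%N = Ugrp R (16 * n) /\
  forall k, (k <= 7)%N ->
    top_dim (s_centriole (Pt k) (emb (J k)) (- emb (J k))) (Pt k.+1).

End BottChains.

(* Main.v *)
(* A curve G of unitary matrices in a component C of the set Q_k of unitary
   complex structures anticommuting with J_1, ..., J_(k-1) is a geodesic of C
   only if X = G^* G' is constant: the derivative of X is skew and G X' is again
   tangent to C, so that orthogonality of G'' to it gives |X'|^2 = 0.  Hence
   G(a + b) = G(a) G(0)^* G(b), which forces the midpoint of a geodesic from J_k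
   to -J_k to lie in Q_(k+1); conversely cos(pi t) J_k + sin(pi t) A is such a
   geodesic for A in Q_(k+1).  So each centrosome is C intersected with Q_(k+1),
   and the terms of the U-chain are components of the sets Q_k.

   On the last term, A |-> - A J_8 takes values in the commutant of J_1, ...,
   J_7, where J_8 is a point of P_8.  The products T1, T2, T3, w of the J_i are
   commuting involutions whose joint +1 eigenspace has dimension n; cutting
   - A J_8 down to that eigenspace in a real orthonormal basis E gives a unitary
   n x n matrix.  Conjugation with K1, K2, K3 and J_8 moves that eigenspace to
   the 15 other joint eigenspaces, which provides the inverse map and the factor
   16 of the metric.  Both maps are restrictions of linear maps and E is real, so
   that real points correspond to O_n; connectedness singles out SO_n. *)

Require Import Defs.
From HB Require Import structures.
From mathcomp Require Import all_boot all_order all_algebra perm.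
From mathcomp Require Import all_classical all_reals all_analysis.
From mathcomp Require Import complex.
From mathcomp Require Import ring zify.

Set Implicit Arguments.
Unset Strict Implicit.
Unset Printing Implicit Defensive.

Import Order.TTheory GRing.Theory Num.Theory.
Import numFieldNormedType.Exports.

Local Open Scope classical_set_scope.
Local Open Scope ring_scope.
Local Open Scope sesquilinear_scope.

(** * Linear maps and curves in normed spaces *)

(** A tangent vector is by definition the velocity of a curve inside the set, so tangency needs
    explicit curves in [C]. The spectral theorem supplies them: exp(sY) for a skew-Hermitian [Y] is
    written in an eigenbasis with cosines and sines, so that smoothness and commutation rules become
    computations on entries.

    The Clifford words come from counting letters. A word of three distinct letters squares to 1,
    and two such words commute exactly when they share an odd number of letters; {0,1,2}, {0,3,4}
    and {1,3,5} share one pairwise. The letters 2, 4, 5 each lie in just one of these sets and 6 in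
    none, so their products with 6 flip a single [T_i]. The seven-letter word [w] commutes with the
    letters 0 to 6, and the eighth generator flips it. Such signs are evaluated through a normal
    form of words.

    This algebra lives in an abstract ring with a central half because it serves twice: for real
    matrices, to obtain a real frame, and for complex ones, to fold and unfold. The complex set Q_8
    is an image of U_n, hence connected, so the last term of the U-chain is all of it. *)

Section LinearMaps.
Variables (R : realType) (V W : normedModType R) (F : V -> W).
Hypotheses (F_lin : linear F) (F_cont : continuous F).

Lemma linear_mapD x y : F (x + y) = F x + F y.
Proof. by have := F_lin 1 x y; rewrite !scale1r. Qed.

Lemma linear_map0 : F 0 = 0.
Proof. by apply: (addrI (F 0)); rewrite -linear_mapD !addr0. Qed.

Lemma linear_mapZ a x : F (a *: x) = a *: F x.
Proof. by have := F_lin a x 0; rewrite !addr0 linear_map0 addr0. Qed.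

Lemma linear_mapB x y : F (x - y) = F x - F y.
Proof. by rewrite linear_mapD -scaleN1r linear_mapZ scaleN1r. Qed.

Lemma is_derive_linear (c : R -> V) (t : R) (v : V) :
  is_derive t 1 c v -> is_derive t 1 (F \o c) (F v).
Proof.
move=> [dc <-].
have cvgF : (fun h => h^-1 *: ((F \o c \o shift t) (h *: 1) - (F \o c) t))
    @ 0^' --> F ('D_1 c t).
  rewrite [X in X @ _](_ : _ =
      F \o (fun h => h^-1 *: ((c \o shift t) (h *: 1) - c t))); last first.
    by apply: funext => h /=; rewrite linear_mapZ linear_mapB.
  apply: (@continuous_cvg _ _ _ _ _ _ F ('D_1 c t)); first exact: F_cont.
  exact: dc.
by split; [exact: (cvgP _ cvgF) | exact: cvg_lim cvgF].
Qed.

Lemma is_derive_linear_fun (x v : V) : is_derive x v F (F v).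
Proof.
have cvgF : (fun h => h^-1 *: ((F \o shift x) (h *: v) - F x)) @ 0^' --> F v.
  apply: (cvg_trans _ (@cvg_cst _ (F v) _ (0 : R)^' _)).
  apply: near_eq_cvg; near=> h => /=.
  rewrite linear_mapD addrK linear_mapZ scalerA mulVf ?scale1r //.
  by near: h; exact: nbhs_dnbhs_neq.
by split; [exact: (cvgP _ cvgF) | exact: cvg_lim cvgF].
Unshelve. all: by end_near. Qed.

(** The first directional derivative of a linear map is the constant [F v] and the later ones
    vanish, so every iterated derivative is either [F] or a constant. *)
Lemma smooth_linear (U : set V) : smooth_on_open U F.
Proof.
move=> vs x _ G; have : G = F \/ exists w, G = cst w.
  rewrite {}/G.
  elim: vs => [|v vs /= [->|[w ->]]]; first by left.
    right; exists (F v); apply: funext => y.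
    by have [_ ->] := is_derive_linear_fun y v.
  by right; exists 0; apply: funext => y; rewrite derive_cst.
move: G => G [->|[w ->]]; split=> //; last exact: cvg_cst.
  by move=> v; have [] := is_derive_linear_fun x v.
exact: F_cont.
Qed.

End LinearMaps.

Lemma is_derive_mxP (R : realType) (m n : nat) (c : R -> 'M[R]_(m, n)) (t : R)
    (D : 'M[R]_(m, n)) :
  is_derive t 1 c D <-> forall i j, is_derive t 1 (fun s => c s i j) (D i j).
Proof.
split=> [[dc <-] i j | dc].
  split; first by move/derivable_mxP: dc.
  by rewrite derive_mx // mxE.
have dc' : derivable c t 1 by apply/derivable_mxP => i j; have [] := dc i j.
split=> //; rewrite derive_mx //; apply/matrixP => i j; rewrite mxE.
by have [] := dc i j.
Qed.

Lemma is_derive_pairP (R : realType) (V W : normedModType R) (c : R -> V * W)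
    (t : R) (d : V * W) :
  is_derive t 1 c d <->
  is_derive t 1 (fun s => (c s).1) d.1 /\ is_derive t 1 (fun s => (c s).2) d.2.
Proof.
split=> [dc | [d1 d2]].
  by split; [apply: (@is_derive_linear _ _ _ fst) dc => // x; exact: cvg_fst
            |apply: (@is_derive_linear _ _ _ snd) dc => // x; exact: cvg_snd].
have inl_cont : continuous (fun v : V => (v, 0 : W)).
  by move=> v; apply: cvg_pair; [exact: cvg_id | exact: cvg_cst].
have inr_cont : continuous (fun w : W => (0 : V, w)).
  by move=> w; apply: cvg_pair; [exact: cvg_cst | exact: cvg_id].
have e1 : is_derive t 1 (fun s => ((c s).1, 0 : W)) (d.1, 0).
  apply: (is_derive_linear _ inl_cont d1) => a x y.
  by congr pair; rewrite /= scaler0 addr0.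
have e2 : is_derive t 1 (fun s => (0 : V, (c s).2)) (0, d.2).
  apply: (is_derive_linear _ inr_cont d2) => a x y.
  by congr pair; rewrite /= scaler0 addr0.
have := is_deriveD e1 e2.
have -> : (d.1, 0 : W) + (0 : V, d.2) = d.
  by rewrite [d in RHS]surjective_pairing; congr pair; rewrite /= ?addr0 ?add0r.
suff -> : (fun s => ((c s).1, 0 : W)) + (fun s => (0 : V, (c s).2)) = c by [].
apply: funext => s; rewrite [RHS]surjective_pairing.
by congr pair; rewrite /= ?addr0 ?add0r.
Qed.

Lemma derivable_is_derive1 (R : realType) (V : normedModType R) (c : R -> V)
    (t : R) : derivable c t 1 -> is_derive t 1 c (derive1 c t).
Proof. by move=> dc; split=> //; rewrite derive1E. Qed.

Lemma is_derive1_eq (R : realType) (V : normedModType R) (c : R -> V) (t : R)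
    (d : V) : is_derive t 1 c d -> derive1 c t = d.
Proof. by case=> _ <-; rewrite derive1E. Qed.

Lemma derivable1_continuous (R : realType) (V : normedModType R) (c : R -> V) :
  (forall t, derivable c t 1) -> continuous c.
Proof.
by move=> dc t; apply/differentiable_continuous/derivable1_diffP; exact: dc.
Qed.

Lemma connected_curve (R : realType) (V : topologicalType) (c : R -> V) :
  continuous c -> connected (range c).
Proof.
move=> cc; apply: connected_continuous_connected.
  by apply/connected_intervalP => x y z.
exact: continuous_subspaceT.
Qed.

(** The device for placing explicit curves in a component: one point in [C] and membership in the
    ambient set suffice. *)
Lemma component_curve (R : realType) (V : topologicalType) (A C : set V)
    (c : R -> V) (s : R) :
  C = connected_component A (c s) -> continuous c -> (forall t, A (c t)) ->
  forall t, C (c t).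
Proof.
move=> -> cc cA t; apply: (connected_component_max _ _ (connected_curve cc)).
- by exists s.
- by move=> _ [u _ <-].
- by exists t.
Qed.
(** * Complex matrices as a real normed space *)

Lemma trace_mul_tr (R : realType) (m n : nat) (M : 'M[R]_(m, n)) :
  \tr (M *m M^T) = \sum_i \sum_j M i j ^+ 2.
Proof.
apply: eq_bigr => i _; rewrite !mxE; apply: eq_bigr => j _.
by rewrite mxE expr2.
Qed.

Lemma trace_mul_tr_ge0 (R : realType) (m n : nat) (M : 'M[R]_(m, n)) :
  0 <= \tr (M *m M^T).
Proof.
by rewrite trace_mul_tr; apply: sumr_ge0 => i _; apply: sumr_ge0 => j _; rewrite sqr_ge0.
Qed.

Lemma trace_mul_tr_eq0 (R : realType) (m n : nat) (M : 'M[R]_(m, n)) :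
  \tr (M *m M^T) = 0 -> M = 0.
Proof.
have row_ge0 i : 0 <= \sum_j M i j ^+ 2.
  by apply: sumr_ge0 => j _; rewrite sqr_ge0.
rewrite trace_mul_tr => /(psumr_eq0P (fun i _ => row_ge0 i)) M0.
apply/matrixP => i j; rewrite mxE; apply/eqP; rewrite -sqrf_eq0; apply/eqP.
by apply: (psumr_eq0P _ (M0 i isT)) => // k _; rewrite sqr_ge0.
Qed.

Section ComplexMatrices.
Variable R : realType.
Local Notation Re := (@complex.Re R).
Local Notation Im := (@complex.Im R).

Lemma complex_eqP (x y : R[i]) : Re x = Re y -> Im x = Im y -> x = y.
Proof. by case: x y => [a b] [c d] /= -> ->. Qed.

Lemma cReD (x y : R[i]) : Re (x + y) = Re x + Re y.
Proof. by case: x y => [a b] [c d]. Qed.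

Lemma cImD (x y : R[i]) : Im (x + y) = Im x + Im y.
Proof. by case: x y => [a b] [c d]. Qed.

Lemma cReN (x : R[i]) : Re (- x) = - Re x.
Proof. by case: x. Qed.

Lemma cImN (x : R[i]) : Im (- x) = - Im x.
Proof. by case: x. Qed.

Lemma cReM (x y : R[i]) : Re (x * y) = Re x * Re y - Im x * Im y.
Proof. by case: x y => [a b] [c d]. Qed.

Lemma cImM (x y : R[i]) : Im (x * y) = Re x * Im y + Im x * Re y.
Proof. by case: x y => [a b] [c d]. Qed.

Lemma cRe_sum (I : Type) (r : seq I) (F : I -> R[i]) :
  Re (\sum_(i <- r) F i) = \sum_(i <- r) Re (F i).
Proof. by elim/big_rec2: _ => [//|i y x _ <-]; rewrite cReD. Qed.

Lemma cIm_sum (I : Type) (r : seq I) (F : I -> R[i]) :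
  Im (\sum_(i <- r) F i) = \sum_(i <- r) Im (F i).
Proof. by elim/big_rec2: _ => [//|i y x _ <-]; rewrite cImD. Qed.

Lemma cRe_conj (x : R[i]) : Re (Num.conj x) = Re x.
Proof. by case: x. Qed.

Lemma cIm_conj (x : R[i]) : Im (Num.conj x) = - Im x.
Proof. by case: x. Qed.

Definition adj (m n : nat) (A : 'M[R[i]]_(m, n)) : 'M[R[i]]_(n, m) :=
  A^t*.

Lemma unitary_invmx (n : nat) (A : 'M[R[i]]_n) :
  A \is unitarymx -> invmx A = adj A.
Proof. exact: invmx_unitary. Qed.

Lemma adjM (m n p : nat) (A : 'M[R[i]]_(m, n)) (B : 'M[R[i]]_(n, p)) :
  adj (A *m B) = adj B *m adj A.
Proof. by rewrite /adj trmx_mul map_mxM. Qed.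

Lemma adjK (m n : nat) (A : 'M[R[i]]_(m, n)) : adj (adj A) = A.
Proof. exact: trmxCK. Qed.

Lemma adjD (m n : nat) (A B : 'M[R[i]]_(m, n)) : adj (A + B) = adj A + adj B.
Proof. by rewrite /adj linearD map_mxD. Qed.

Lemma adjN (m n : nat) (A : 'M[R[i]]_(m, n)) : adj (- A) = - adj A.
Proof. by rewrite /adj linearN map_mxN. Qed.

Lemma adj1 (n : nat) : adj (1%:M : 'M[R[i]]_n) = 1%:M.
Proof. by rewrite /adj trmx1 map_mx1. Qed.

Lemma unitaryP (n : nat) (A : 'M[R[i]]_n) :
  reflect (A *m adj A = 1%:M) (A \is unitarymx).
Proof. exact: unitarymxP. Qed.

Lemma unitary_mul_adj (n : nat) (A : 'M[R[i]]_n) :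
  A \is unitarymx -> A *m adj A = 1%:M.
Proof. by move/unitaryP. Qed.

Lemma unitary_adj_mul (n : nat) (A : 'M[R[i]]_n) :
  A \is unitarymx -> adj A *m A = 1%:M.
Proof. by move/unitaryP/mulmx1C. Qed.

Lemma trace_adj (n : nat) (A : 'M[R[i]]_n) : Re (\tr (adj A)) = Re (\tr A).
Proof.
by rewrite /mxtrace !cRe_sum; apply: eq_bigr => i _; rewrite !mxE cRe_conj.
Qed.

Variable N : nat.
Implicit Types (z w : cmat R N) (A B : 'M[R[i]]_N).

Definition ofC A : cmat R N := (map_mx Re A, map_mx Im A).

Lemma ofCK A : toC (ofC A) = A.
Proof. by apply/matrixP => i j; rewrite !mxE; apply: complex_eqP. Qed.

Lemma toCK z : ofC (toC z) = z.
Proof.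
by case: z => a b; congr pair; apply/matrixP => i j; rewrite !mxE.
Qed.

Lemma toC_inj : injective (@toC R N).
Proof. exact: (can_inj toCK). Qed.

Lemma ofC_inj : injective ofC.
Proof. exact: (can_inj ofCK). Qed.

Lemma toCD z w : toC (z + w) = toC z + toC w.
Proof. by apply/matrixP => i j; rewrite !mxE; apply: complex_eqP. Qed.

Lemma toCN z : toC (- z) = - toC z.
Proof. by apply/matrixP => i j; rewrite !mxE; apply: complex_eqP. Qed.

Lemma toCZ (a : R) z : toC (a *: z) = (a%:C)%C *: toC z.
Proof.
apply/matrixP => i j; rewrite !mxE; apply: complex_eqP => /=.
  by rewrite mul0r subr0.
by rewrite mul0r addr0.
Qed.

Lemma ofCD A B : ofC (A + B) = ofC A + ofC B.
Proof. by apply: toC_inj; rewrite toCD !ofCK. Qed.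

Lemma ofCZ (a : R) A : ofC ((a%:C)%C *: A) = a *: ofC A.
Proof. by apply: toC_inj; rewrite toCZ !ofCK. Qed.

Lemma toC_emb (A : 'M[R]_N) : toC (emb A) = map_mx (real_complex R) A.
Proof. by apply/matrixP => i j; rewrite !mxE. Qed.

Lemma dotmx_trace z w : Defs.dotmx z w = Re (\tr (toC z *m adj (toC w))).
Proof.
rewrite /Defs.dotmx /mxtrace cRe_sum -big_split; apply: eq_bigr => j _.
rewrite !mxE cRe_sum -big_split; apply: eq_bigr => k _.
by rewrite !mxE cReM cRe_conj cIm_conj /= mulrN opprK.
Qed.

Lemma dotmx_eq0 z : Defs.dotmx z z = 0 -> z = 0.
Proof.
move=> /eqP; rewrite paddr_eq0 ?trace_mul_tr_ge0 //.
move=> /andP[/eqP/trace_mul_tr_eq0 z1 /eqP/trace_mul_tr_eq0 z2].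
by rewrite [z]surjective_pairing z1 z2.
Qed.

(* The derivative of a curve of complex matrices, taken in the real normed
   space of pairs. *)
Definition is_mxderive (G : R -> 'M[R[i]]_N) (t : R) (D : 'M[R[i]]_N) : Prop :=
  is_derive t 1 (fun s => ofC (G s)) (ofC D).

Lemma is_mxderiveP (G : R -> 'M[R[i]]_N) (t : R) (D : 'M[R[i]]_N) :
  is_mxderive G t D <->
  forall i j, is_derive t 1 (fun s => Re (G s i j)) (Re (D i j)) /\
              is_derive t 1 (fun s => Im (G s i j)) (Im (D i j)).
Proof.
have entry (f : R[i] -> R) i j :
    (fun s => map_mx f (G s) i j) = (fun s => f (G s i j)).
  by apply: funext => s; rewrite mxE.
rewrite /is_mxderive is_derive_pairP /= !is_derive_mxP; split.
  by move=> [dR dI] i j; rewrite -!entry; move: (dR i j) (dI i j); rewrite !mxE.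
by move=> dG; split=> i j; rewrite entry mxE; have [] := dG i j.
Qed.

Lemma is_mxderive_unique (G : R -> 'M[R[i]]_N) (t : R) (D E : 'M[R[i]]_N) :
  is_mxderive G t D -> is_mxderive G t E -> D = E.
Proof. by move=> [_ D1] [_ E1]; apply: ofC_inj; rewrite -D1 -E1. Qed.

Lemma is_mxderive_toC (c : R -> cmat R N) (t : R) :
  derivable c t 1 -> is_mxderive (fun s => toC (c s)) t (toC (derive1 c t)).
Proof.
move=> /derivable_is_derive1 dc; rewrite /is_mxderive toCK.
by under eq_fun do rewrite toCK.
Qed.

Lemma is_mxderive_cst (A : 'M[R[i]]_N) (t : R) :
  is_mxderive (fun=> A) t 0.
Proof. by apply/is_mxderiveP => i j; rewrite mxE; split; exact: is_derive_cst. Qed.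

Lemma is_mxderiveD (G H : R -> 'M[R[i]]_N) (t : R) (D E : 'M[R[i]]_N) :
  is_mxderive G t D -> is_mxderive H t E ->
  is_mxderive (fun s => G s + H s) t (D + E).
Proof.
move=> /is_mxderiveP dG /is_mxderiveP dH; apply/is_mxderiveP => i j.
have [dGr dGi] := dG i j; have [dHr dHi] := dH i j.
rewrite mxE cReD cImD; split.
  under eq_fun do rewrite mxE cReD; exact: is_deriveD.
under eq_fun do rewrite mxE cImD; exact: is_deriveD.
Qed.

Lemma is_mxderiveN (G : R -> 'M[R[i]]_N) (t : R) (D : 'M[R[i]]_N) :
  is_mxderive G t D -> is_mxderive (fun s => - G s) t (- D).
Proof.
move=> /is_mxderiveP dG; apply/is_mxderiveP => i j.
have [dGr dGi] := dG i j; rewrite mxE cReN cImN; split.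
  under eq_fun do rewrite mxE cReN; exact: is_deriveN.
under eq_fun do rewrite mxE cImN; exact: is_deriveN.
Qed.

Lemma is_mxderive_adj (G : R -> 'M[R[i]]_N) (t : R) (D : 'M[R[i]]_N) :
  is_mxderive G t D -> is_mxderive (fun s => adj (G s)) t (adj D).
Proof.
move=> /is_mxderiveP dG; apply/is_mxderiveP => i j.
have [dGr dGi] := dG j i; rewrite !mxE cRe_conj cIm_conj; split.
  by under eq_fun do rewrite !mxE cRe_conj.
under eq_fun do rewrite !mxE cIm_conj; exact: is_deriveN.
Qed.

Lemma is_mxderiveM (G H : R -> 'M[R[i]]_N) (t : R) (D E : 'M[R[i]]_N) :
  is_mxderive G t D -> is_mxderive H t E ->
  is_mxderive (fun s => G s *m H s) t (D *m H t + G t *m E).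
Proof.
move=> /is_mxderiveP dG /is_mxderiveP dH; apply/is_mxderiveP => i j.
have dM (f g : R -> R) df dg : is_derive t 1 f df -> is_derive t 1 g dg ->
    is_derive t 1 (fun s => f s * g s) (df * g t + f t * dg).
  move=> d1 d2; have := is_deriveM d1 d2.
  by rewrite addrC /GRing.scale /= [g t * df]mulrC.
rewrite !mxE -big_split cRe_sum cIm_sum; split.
  have -> : (fun s => Re ((G s *m H s) i j)) =
      \sum_k (fun s => Re (G s i k) * Re (H s k j) - Im (G s i k) * Im (H s k j)).
    apply: funext => s; rewrite fct_sumE !mxE cRe_sum.
    by apply: eq_bigr => k _; rewrite cReM.
  apply: is_derive_sum => k; have [dGr dGi] := dG i k; have [dHr dHi] := dH k j.
  have := is_deriveB (dM _ _ _ _ dGr dHr) (dM _ _ _ _ dGi dHi).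
  by rewrite /= cReD !cReM opprD addrACA.
have -> : (fun s => Im ((G s *m H s) i j)) =
    \sum_k (fun s => Re (G s i k) * Im (H s k j) + Im (G s i k) * Re (H s k j)).
  apply: funext => s; rewrite fct_sumE !mxE cIm_sum.
  by apply: eq_bigr => k _; rewrite cImM.
apply: is_derive_sum => k; have [dGr dGi] := dG i k; have [dHr dHi] := dH k j.
have := is_deriveD (dM _ _ _ _ dGr dHi) (dM _ _ _ _ dGi dHr).
by rewrite /= cImD !cImM addrACA.
Qed.

Lemma is_mxderiveMr (A : 'M[R[i]]_N) (G : R -> 'M[R[i]]_N) (t : R)
    (D : 'M[R[i]]_N) :
  is_mxderive G t D -> is_mxderive (fun s => A *m G s) t (A *m D).
Proof.
by move=> dG; have := is_mxderiveM (is_mxderive_cst A t) dG; rewrite mul0mx add0r.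
Qed.

Lemma is_mxderiveMl (A : 'M[R[i]]_N) (G : R -> 'M[R[i]]_N) (t : R)
    (D : 'M[R[i]]_N) :
  is_mxderive G t D -> is_mxderive (fun s => G s *m A) t (D *m A).
Proof.
by move=> dG; have := is_mxderiveM dG (is_mxderive_cst A t); rewrite mulmx0 addr0.
Qed.

Lemma is_mxderive0_cst (G : R -> 'M[R[i]]_N) :
  (forall t, is_mxderive G t 0) -> forall s t, G s = G t.
Proof.
move=> dG s t; apply/matrixP => i j; apply: complex_eqP.
  apply: (is_derive_0_is_cst (f := fun u => Re (G u i j))) => u.
  by have /is_mxderiveP/(_ i j)[] := dG u; rewrite mxE.
apply: (is_derive_0_is_cst (f := fun u => Im (G u i j))) => u.
by have /is_mxderiveP/(_ i j)[] := dG u; rewrite mxE.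
Qed.

End ComplexMatrices.
(** * Trigonometric curves *)

Section TrigonometricCurves.
Variables (R : realType) (V : normedModType R).
Implicit Types (m : nat) (B D : V).

(** This family is closed under differentiation, which only exchanges and rescales the coefficients;
    derivability to all orders is then an induction. *)
Definition trig_sum m (th : 'I_m -> R) (B D : 'I_m -> V) (s : R) : V :=
  \sum_j (cos (th j * s) *: B j + sin (th j * s) *: D j).

Lemma is_derive_scalel (f : R -> R) (t df : R) B :
  is_derive t 1 f df -> is_derive t 1 (fun s => f s *: B) (df *: B).
Proof.
apply: (@is_derive_linear _ R^o V (fun x => x *: B)) => [a x y|x].
  by rewrite scalerDl scalerA.
exact: scalel_continuous.
Qed.

Lemma is_derive_trig_sum m (th : 'I_m -> R) (B D : 'I_m -> V) (t : R) :
  is_derive t 1 (trig_sum th B D)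
    (trig_sum th (fun j => th j *: D j) (fun j => - th j *: B j) t).
Proof.
pose h j := (fun s : R => cos (th j * s) *: B j) + (fun s => sin (th j * s) *: D j).
have dh j : is_derive t 1 (h j)
    (cos (th j * t) *: (th j *: D j) + sin (th j * t) *: (- th j *: B j)).
  have dth : is_derive t 1 (fun s => th j * s) (th j).
    have := is_deriveZ (th j) (is_derive_id t 1).
    by rewrite [_ *: _]mulr1.
  have dcos := @is_derive_scalel _ _ _ (B j)
    (@is_derive1_comp R (@cos R) _ _ _ _ (is_derive_cos (th j * t)) dth).
  have dsin := @is_derive_scalel _ _ _ (D j)
    (@is_derive1_comp R (@sin R) _ _ _ _ (is_derive_sin (th j * t)) dth).
  apply: (is_derive_eq (is_deriveD dcos dsin)).
  by rewrite addrC !scalerA mulNr -mulrN.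
have := @is_derive_sum _ _ _ _ h t 1 _ dh.
suff -> : \sum_j h j = trig_sum th B D by [].
by apply: funext => s; rewrite fct_sumE.
Qed.

Lemma derive1_trig_sum m (th : 'I_m -> R) (B D : 'I_m -> V) :
  derive1 (trig_sum th B D) =
  trig_sum th (fun j => th j *: D j) (fun j => - th j *: B j).
Proof. by apply: funext => t; apply: is_derive1_eq (is_derive_trig_sum _ _ _ _). Qed.

Lemma derivable_trig_sum m (th : 'I_m -> R) (B D : 'I_m -> V) k (t : R) :
  derivable (derive1n k (trig_sum th B D)) t 1.
Proof.
elim: k B D => [|k IHk] B D; first by have [] := is_derive_trig_sum th B D t.
by rewrite derive1Sn derive1_trig_sum; exact: IHk.
Qed.

Lemma continuous_trig_sum m (th : 'I_m -> R) (B D : 'I_m -> V) :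
  continuous (trig_sum th B D).
Proof.
by apply: derivable1_continuous => t; exact: (@derivable_trig_sum _ th B D 0 t).
Qed.

End TrigonometricCurves.

Section SpectralCurves.
Variables (R : realType) (N : nat).
Implicit Types (L M : 'M[R[i]]_N) (th : 'I_N -> R).

Definition cis (x : R) : R[i] := (cos x +i* sin x)%C.

Lemma cis0 : cis 0 = 1.
Proof. by rewrite /cis cos0 sin0. Qed.

Lemma cisD x y : cis (x + y) = cis x * cis y.
Proof. apply: complex_eqP; rewrite ?cReM ?cImM /=; first exact: cosD.
by rewrite sinD addrC. Qed.

Lemma conj_cis x : Num.conj (cis x) = cis (- x).
Proof.
by apply: complex_eqP; rewrite ?cRe_conj ?cIm_conj /= ?cosN ?sinN.
Qed.

Lemma cis_mulN x : cis x * cis (- x) = 1.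
Proof. by rewrite -cisD subrr cis0. Qed.

(** For unitary [P], the case [L = adj P], [M = P] is exp(sY), where [Y] is skew-Hermitian with
    eigenvalues ['i * th j] in the eigenbasis [P]. A free left factor [L] also covers the translates
    G exp(sY). *)
Definition cis_curve L M th (s : R) : 'M[R[i]]_N :=
  L *m diag_mx (\row_j cis (th j * s)) *m M.

Lemma ofC_cis_curve L M th :
  (fun s => ofC (cis_curve L M th s)) =
  trig_sum th (fun j => ofC (L *m delta_mx j j *m M))
              (fun j => ofC ('i%C *: (L *m delta_mx j j *m M))).
Proof.
apply: funext => s; rewrite /cis_curve diag_mx_sum_delta.
rewrite mulmx_sumr mulmx_suml; apply: toC_inj; rewrite ofCK.
rewrite /trig_sum (big_morph _ (@toCD R N) (_ : toC 0 = 0)); last first.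
  by apply/matrixP => i j; rewrite !mxE.
apply: eq_bigr => j _; rewrite toCD !toCZ !ofCK mxE scalerA -scalerDl.
rewrite -scalemxAr -scalemxAl; congr (_ *: _); apply: complex_eqP => /=.
  by rewrite mulr0 mul0r subr0 addr0.
by rewrite mulr1 mul0r addr0 add0r.
Qed.

Lemma smooth_cis_curve (S : set (cmat R N)) L M th :
  (forall s, S (ofC (cis_curve L M th s))) ->
  smooth_curve S (fun s => ofC (cis_curve L M th s)).
Proof.
by move=> cS; split=> // k t; rewrite ofC_cis_curve; exact: derivable_trig_sum.
Qed.

Lemma continuous_cis_curve L M th :
  continuous (fun s => ofC (cis_curve L M th s)).
Proof. by rewrite ofC_cis_curve; exact: continuous_trig_sum. Qed.

Lemma derive1_cis_curve0 L M th :
  derive1 (fun s => ofC (cis_curve L M th s)) 0 =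
  ofC (L *m diag_mx (\row_j ('i%C * (th j)%:C%C)) *m M).
Proof.
rewrite ofC_cis_curve derive1_trig_sum /trig_sum diag_mx_sum_delta.
rewrite mulmx_sumr mulmx_suml; apply: toC_inj; rewrite ofCK.
rewrite (big_morph _ (@toCD R N) (_ : toC 0 = 0)); last first.
  by apply/matrixP => i j; rewrite !mxE.
apply: eq_bigr => j _; rewrite mulr0 cos0 sin0 scale1r scale0r addr0 toCZ ofCK.
by rewrite scalerA mxE -scalemxAr -scalemxAl mulrC.
Qed.

Lemma cis_onto (d : R[i]) : d * Num.conj d = 1 -> exists x, d = cis x.
Proof.
case: d => a b /(congr1 (@complex.Re R)) /= ab1.
have {}ab1 : a ^+ 2 + b ^+ 2 = 1 by move: ab1; rewrite mulrN opprK -!expr2.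
have a1 : -1 <= a <= 1.
  have a2 : a ^+ 2 <= 1 by rewrite -ab1 lerDl sqr_ge0.
  by rewrite -ler_norml -(@expr_le1 _ 2) // real_normK ?num_real.
have cosa := acosK a1; have sina := sin_acos a1.
have bE : `|b| = sin (acos a).
  by rewrite sina -ab1 addrAC subrr add0r sqrtr_sqr.
(* [acos] only yields angles with nonnegative sine, so the sign of [b] decides between [acos a] and
   its opposite. *)
have [b0|b0] := leP 0 b.
  by exists (acos a); rewrite /cis cosa -bE ger0_norm.
by exists (- acos a); rewrite /cis cosN sinN cosa -bE ltr0_norm // opprK.
Qed.

End SpectralCurves.
(** * Spectral theorem *)

Section SpectralTheorem.
Variables (R : realType) (N : nat).
Implicit Types (A M P Y : 'M[R[i]]_N) (y : 'I_N -> R).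

Lemma normal_spectral A : A *m adj A = adj A *m A ->
  exists P (d : 'rV[R[i]]_N), P \is unitarymx /\ A = adj P *m diag_mx d *m P.
Proof.
move=> An; have /orthomx_spectralP AE : A \is normalmx by apply/normalmxP.
have PU := spectral_unitarymx A.
exists (spectralmx A), (spectral_diag A); split; first exact: PU.
by rewrite -(unitary_invmx PU).
Qed.

Lemma adj_diag (d : 'rV[R[i]]_N) : adj (diag_mx d) = diag_mx (map_mx Num.conj d).
Proof. by rewrite /adj tr_diag_mx map_diag_mx. Qed.

Lemma adj_conjugate P M : adj (adj P *m M *m P) = adj P *m adj M *m P.
Proof. by rewrite !adjM adjK mulmxA. Qed.

Lemma unitary_conjugate_inj P A B :
  P \is unitarymx -> adj P *m A *m P = adj P *m B *m P -> A = B.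
Proof.
move=> /unitary_mul_adj PU /(congr1 (fun X => P *m X *m adj P)).
by rewrite !mulmxA !PU !mul1mx -!mulmxA !PU !mulmx1.
Qed.

Lemma unitary_conjugateM P A B : P \is unitarymx ->
  (adj P *m A *m P) *m (adj P *m B *m P) = adj P *m (A *m B) *m P.
Proof.
move=> /unitary_mul_adj PU; rewrite -!mulmxA; congr (_ *m (_ *m _)).
by rewrite !mulmxA PU mul1mx.
Qed.

Lemma diag_mx_inj (d e : 'rV[R[i]]_N) : diag_mx d = diag_mx e -> d = e.
Proof.
move=> /matrixP de; apply/rowP => j.
by have := de j j; rewrite !mxE eqxx !mulr1n.
Qed.

Lemma skew_spectral Y : adj Y = - Y ->
  exists P y, P \is unitarymx /\
    Y = adj P *m diag_mx (\row_j ('i%C * (y j)%:C%C)) *m P.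
Proof.
move=> Ysk; have Yn : Y *m adj Y = adj Y *m Y by rewrite Ysk mulmxN mulNmx.
have [P [d [PU YE]]] := normal_spectral Yn.
(* Skewness passes to the diagonal form, so the eigenvalues are purely imaginary. *)
have dN : map_mx Num.conj d = - d.
  apply: diag_mx_inj; rewrite -adj_diag linearN /=.
  apply: (unitary_conjugate_inj PU).
  by rewrite -adj_conjugate -YE mulmxN mulNmx -YE.
exists P, (fun j => complex.Im (d 0 j)); split; first exact: PU.
rewrite {1}YE.
congr (_ *m diag_mx _ *m _); apply/rowP => j; rewrite !mxE.
have := congr1 (fun M : 'rV_N => complex.Re (M 0 j)) dN.
rewrite !mxE cRe_conj cReN => /eqP; rewrite -addr_eq0 -mulr2n mulrn_eq0 /=.
move=> /eqP d0; apply: complex_eqP; rewrite ?cReM ?cImM /= ?mul0r ?mul1r ?subr0 //.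
by rewrite add0r.
Qed.

Lemma unitary_spectral A : A \is unitarymx ->
  exists P y, P \is unitarymx /\ A = adj P *m diag_mx (\row_j cis (y j)) *m P.
Proof.
move=> AU; have An : A *m adj A = adj A *m A.
  by rewrite (unitary_mul_adj AU) (unitary_adj_mul AU).
have [P [d [PU AE]]] := normal_spectral An.
have dU j : d 0 j * Num.conj (d 0 j) = 1.
  have : diag_mx d *m diag_mx (map_mx Num.conj d) = 1%:M.
    apply: (unitary_conjugate_inj PU).
    rewrite -adj_diag -(unitary_conjugateM _ _ PU) -adj_conjugate -AE.
    by rewrite (unitary_mul_adj AU) mulmx1 (unitary_adj_mul PU).
  move=> /matrixP/(_ j j); rewrite mulmx_diag !mxE eqxx !mulr1n.
  by [].
have [y dE] := choice (fun j => cis_onto (dU j)).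
exists P, y; split; first exact: PU.
rewrite AE; congr (_ *m diag_mx _ *m _).
by apply/rowP => j; rewrite mxE dE.
Qed.

Lemma cis_curve0 P y : P \is unitarymx -> cis_curve (adj P) P y 0 = 1%:M.
Proof.
move=> PU; rewrite /cis_curve.
have -> : \row_j cis (y j * 0) = const_mx 1 :> 'rV[R[i]]_N.
  by apply/rowP => j; rewrite !mxE mulr0 cis0.
by rewrite diag_const_mx mulmx1 unitary_adj_mul.
Qed.

Lemma adj_cis_curve P y s :
  adj (cis_curve (adj P) P y s) = cis_curve (adj P) P y (- s).
Proof.
rewrite /cis_curve adj_conjugate adj_diag; congr (_ *m diag_mx _ *m _).
by apply/rowP => j; rewrite !mxE conj_cis mulrN.
Qed.

Lemma cis_curve_unitary P y s :
  P \is unitarymx -> cis_curve (adj P) P y s \is unitarymx.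
Proof.
move=> PU; apply/unitaryP; rewrite adj_cis_curve (unitary_conjugateM _ _ PU) mulmx_diag.
rewrite -(cis_curve0 y PU) /cis_curve; congr (_ *m diag_mx _ *m _).
by apply/rowP => j; rewrite !mxE mulrN cis_mulN mulr0 cis0.
Qed.

(* In an eigenbasis of Y the (j, k) entry of M vanishes unless the eigenvalues
   satisfy [y k = e * y j], and then [cis (y k * s) = cis (y j * (e * s))]. *)
Lemma cis_curve_intertwine P y M (e s : R) : P \is unitarymx ->
  let Y := adj P *m diag_mx (\row_j ('i%C * (y j)%:C%C)) *m P in
  M *m Y = e%:C%C *: (Y *m M) ->
  M *m cis_curve (adj P) P y s = cis_curve (adj P) P y (e * s) *m M.
Proof.
move=> PU Y MY.
have [M' ME] : exists M', M = adj P *m M' *m P.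
  exists (P *m M *m adj P); rewrite !mulmxA (unitary_adj_mul PU) mul1mx -mulmxA.
  by rewrite (unitary_adj_mul PU) mulmx1.
pose D := diag_mx (\row_j ('i%C * (y j)%:C%C)).
have M'Y : M' *m D = e%:C%C *: (D *m M').
  apply: (unitary_conjugate_inj PU); rewrite -scalemxAr -scalemxAl.
  have MYE : M *m Y = adj P *m (M' *m D) *m P.
    by rewrite -(unitary_conjugateM _ _ PU) -ME.
  have YME : Y *m M = adj P *m (D *m M') *m P.
    by rewrite -(unitary_conjugateM _ _ PU) -ME.
  by rewrite -MYE MY YME.
rewrite ME /cis_curve !(unitary_conjugateM _ _ PU); congr (_ *m _ *m _).
apply/matrixP => j k; move/matrixP: M'Y => /(_ j k).
rewrite [RHS]mxE !mul_mx_diag !mul_diag_mx !mxE => M'Y.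
have [->|M'0] := eqVneq (M' j k) 0; first by rewrite mul0r mulr0.
have {M'Y} : ('i%C : R[i]) * (y k)%:C%C = 'i%C * (e * y j)%:C%C.
  apply: (mulIf M'0); rewrite mulrC M'Y rmorphM !mulrA.
  by rewrite [e%:C%C * _]mulrC.
move=> /(congr1 (@complex.Im R)); rewrite !cImM /= !mul0r !mul1r !add0r => ->.
by rewrite mulrC mulrA [y j * e]mulrC.
Qed.

End SpectralTheorem.
(** * Midpoints of geodesics *)

Lemma is_derive_translate (R : realType) (V : normedModType R) (c : R -> V)
    (a t : R) (v : V) :
  is_derive (t + a) 1 c v -> is_derive t 1 (fun s => c (s + a)) v.
Proof.
move=> [dc <-].
have E : (fun h : R => h^-1 *: (((fun s => c (s + a)) \o shift t) (h *: (1 : R))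
                                 - c (t + a))) =
         (fun h : R => h^-1 *: ((c \o shift (t + a)) (h *: (1 : R)) - c (t + a))).
  by apply: funext => h /=; rewrite addrA.
by split; [rewrite /derivable E | rewrite /derive E].
Qed.

Section BottSets.
Variables (R : realType) (N : nat) (J : nat -> 'M[R[i]]_N).

(** The guards let one definition serve all stages: at [k = 0] only unitarity remains, which gives
    the whole unitary group, and at [k = 1] no anticommutation is required. *)
Definition bott_set (k : nat) : set 'M[R[i]]_N :=
  [set A | [/\ A \is unitarymx, (0 < k)%N -> A *m A = - 1%:M &
               forall i, (0 < i < k)%N -> A *m J i = - (J i *m A)]].

Definition bott (k : nat) : set (cmat R N) := [set z | bott_set k (toC z)].

Lemma square_oppr1_adj (A : 'M[R[i]]_N) :
  A \is unitarymx -> A *m A = - 1%:M -> adj A = - A.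
Proof.
move=> AU A2; rewrite -[adj A]mulmx1 -[1%:M]opprK -A2 mulmxN mulmxA.
by rewrite (unitary_adj_mul AU) mul1mx.
Qed.

(** Let E = exp(sY). Since [A] anticommutes with [Y], A E = adj E A, hence (A E)(A E) = adj E A A E
    = -1; since the [J i] commute with [Y], they commute with E. Both are instances of
    [cis_curve_intertwine], with [e = -1] and [e = 1]. *)
Lemma unitary_exp_anticomm (k : nat) (A Y P : 'M[R[i]]_N) (y : 'I_N -> R) s :
  P \is unitarymx ->
  Y = adj P *m diag_mx (\row_j ('i%C * (y j)%:C%C)) *m P ->
  bott_set k A -> ((0 < k)%N -> A *m Y = - (Y *m A)) ->
  (forall i, (0 < i < k)%N -> J i *m Y = Y *m J i) ->
  bott_set k (A *m cis_curve (adj P) P y s).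
Proof.
move=> PU YE [AU A2 AJ] AY JY; set E := cis_curve _ _ _.
have EU u : E u \is unitarymx by exact: cis_curve_unitary.
have AE : (0 < k)%N -> A *m E s = adj (E s) *m A.
  move=> k0; rewrite adj_cis_curve -mulN1r; apply: (cis_curve_intertwine s PU).
  by rewrite -YE (AY k0) rmorphN scaleN1r.
have JE i : (0 < i < k)%N -> J i *m E s = E s *m J i.
  move=> ik; rewrite -[X in _ = E X *m _]mul1r.
  by apply: (cis_curve_intertwine s PU); rewrite -YE (JY i ik) rmorph1 scale1r.
move: (E s) (EU s) AE JE => F FU AF JF.
split; first exact: (mul_unitarymx AU FU).
  move=> k0; rewrite mulmxA (AF k0) -(mulmxA (adj F) A A) (A2 k0).
  by rewrite mulmxN mulmx1 mulNmx (unitary_adj_mul FU).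
by move=> i ik; rewrite -mulmxA -(JF i ik) !mulmxA (AJ i ik) mulNmx.
Qed.

(** Used to discard the Hermitian part [adj G1 *m G1] of adj G G'' when it is paired with the skew
    matrix [X']. *)
Lemma Re_trace_herm_skew (H S : 'M[R[i]]_N) :
  adj H = H -> adj S = - S -> complex.Re (\tr (H *m S)) = 0.
Proof.
move=> HH SS; have : complex.Re (\tr (H *m S)) = - complex.Re (\tr (H *m S)).
  by rewrite -{1}trace_adj adjM HH SS mulNmx raddfN /= cReN mxtrace_mulC.
by move/eqP; rewrite -addr_eq0 -mulr2n mulrn_eq0 => /eqP.
Qed.

Section Geodesics.
Variables (k : nat) (C : set (cmat R N)) (c : R -> cmat R N).
Hypotheses (C_component : is_component (bott k) C) (c_geodesic : geodesic C c).

Let G s := toC (c s).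
Let G1 s := toC (derive1 c s).
Let G2 s := toC (derive1n 2 c s).
Let X s := adj (G s) *m G1 s.
Let X' s := adj (G1 s) *m G1 s + adj (G s) *m G2 s.

Let bottG t : bott_set k (G t).
Proof.
have [[cC _] _] := c_geodesic; have [x0 _ CE] := C_component.
by have := cC t; rewrite CE => /connected_component_sub.
Qed.

Let dG t : is_mxderive G t (G1 t).
Proof. by have [[_ /(_ 0%N) dc] _] := c_geodesic; exact: is_mxderive_toC. Qed.

Let dG1 t : is_mxderive G1 t (G2 t).
Proof. by have [[_ /(_ 1%N) dc] _] := c_geodesic; exact: is_mxderive_toC. Qed.

Let GU t : G t \is unitarymx. Proof. by case: (bottG t). Qed.

Let dX t : is_mxderive X t (X' t).
Proof. exact: is_mxderiveM (is_mxderive_adj (dG t)) (dG1 t). Qed.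

Let G1E t : G1 t = G t *m X t.
Proof. by rewrite /X mulmxA (unitary_mul_adj (GU t)) mul1mx. Qed.

Let X_skew t : adj (X t) = - X t.
Proof.
have d1 := is_mxderiveM (is_mxderive_adj (dG t)) (dG t).
have d0 : is_mxderive (fun s => adj (G s) *m G s) t 0.
  have -> : (fun s => adj (G s) *m G s) = fun=> 1%:M.
    by apply: funext => s; rewrite (unitary_adj_mul (GU s)).
  exact: is_mxderive_cst.
have /eqP := is_mxderive_unique d1 d0.
by rewrite addr_eq0 => /eqP; rewrite /X adjM adjK.
Qed.

Let X'_skew t : adj (X' t) = - X' t.
Proof.
apply: (is_mxderive_unique (is_mxderive_adj (dX t))).
have -> : (fun s => adj (X s)) = (fun s => - X s) by apply: funext => s.
exact: is_mxderiveN (dX t).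
Qed.

Let X_comm i t : (0 < i < k)%N -> X t *m J i = J i *m X t.
Proof.
move=> ik; have k0 : (0 < k)%N by case/andP: ik => /ltnW; case: (k).
have GJ s : G s *m J i = - (J i *m G s) by case: (bottG s) => _ _; exact.
have adjG s : adj (G s) = - G s.
  by case: (bottG s) => GsU /(_ k0) G2s _; exact: square_oppr1_adj.
have G1J : G1 t *m J i = - (J i *m G1 t).
  apply: (is_mxderive_unique (is_mxderiveMl (J i) (dG t))).
  rewrite (_ : (fun s => G s *m J i) = (fun s => - (J i *m G s))).
    exact: is_mxderiveN (is_mxderiveMr (J i) (dG t)).
  by apply: funext => s; exact: GJ.
(* Here adj G = - G, so [X] is up to sign a product of two matrices that anticommute with [J i]. *)
by rewrite /X adjG !mulNmx -mulmxA G1J !mulmxN !mulmxA GJ mulNmx !opprK.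
Qed.

Let X'_comm i t : (0 < i < k)%N -> J i *m X' t = X' t *m J i.
Proof.
move=> ik; apply: (is_mxderive_unique (is_mxderiveMr (J i) (dX t))).
rewrite (_ : (fun s => J i *m X s) = (fun s => X s *m J i)).
  exact: is_mxderiveMl (dX t).
by apply: funext => s; rewrite (X_comm _ ik).
Qed.

Let X_anti t : (0 < k)%N -> X t *m G t + G t *m X t = 0.
Proof.
move=> k0; have G2s s : G s *m G s = - 1%:M by case: (bottG s) => _ /(_ k0).
have d0 : is_mxderive (fun s => G s *m G s) t 0.
  rewrite (_ : (fun s => G s *m G s) = fun=> - 1%:M); last exact: funext.
  exact: is_mxderive_cst.
have := is_mxderive_unique (is_mxderiveM (dG t) (dG t)) d0.
(* Multiplying the derivative G' G + G G' = 0 of G G = -1 by adj G turns it into X G + G' = 0, and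
   G' = G X. *)
move=> /(congr1 (mulmx (adj (G t)))) e.
rewrite mulmxDr mulmx0 !mulmxA (unitary_adj_mul (GU t)) mul1mx in e.
by rewrite -G1E.
Qed.

Let X'_anti t : (0 < k)%N -> G t *m X' t = - (X' t *m G t).
Proof.
move=> k0; have d0 : is_mxderive (fun s => X s *m G s + G s *m X s) t 0.
  rewrite (_ : (fun s => _) = fun=> 0); first exact: is_mxderive_cst.
  by apply: funext => s; rewrite X_anti.
have := is_mxderive_unique
  (is_mxderiveD (is_mxderiveM (dX t) (dG t)) (is_mxderiveM (dG t) (dX t))) d0.
have -> : X' t *m G t + X t *m G1 t + (G1 t *m X t + G t *m X' t) =
    X' t *m G t + (X t *m G1 t + G1 t *m X t) + G t *m X' t by rewrite !addrA.
have -> : X t *m G1 t + G1 t *m X t = 0.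
  by rewrite G1E mulmxA -mulmxDl (X_anti t k0) mul0mx.
by rewrite addr0 addrC => /eqP; rewrite addr_eq0 => /eqP.
Qed.

Let X'_eq0 t : X' t = 0.
Proof.
have [P [y [PU YE]]] := skew_spectral (X'_skew t).
have cE s : G t *m cis_curve (adj P) P y s = cis_curve (G t *m adj P) P y s.
  by rewrite /cis_curve !mulmxA.
(* The curve G(t) exp(s X'(t)) witnesses that G X' is tangent to [C] at [c t]. *)
pose e s := ofC (cis_curve (G t *m adj P) P y s).
have e0 : e 0 = c t by rewrite /e -cE (cis_curve0 y PU) mulmx1 toCK.
have eC s : C (e s).
  have [x0 _ CE] := C_component; apply: (@component_curve _ _ (bott k) C e 0).
  - rewrite e0 CE; apply: same_connected_component.
    by have [[cC _] _] := c_geodesic; rewrite -CE; exact: cC.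
  - exact: continuous_cis_curve.
  - move=> u; rewrite /bott /= ofCK -cE.
    apply: (unitary_exp_anticomm u PU YE (bottG t)); first exact: X'_anti.
    by move=> i; exact: X'_comm.
have tan : tangent C (c t) (ofC (G t *m X' t)).
  exists e; split=> //; first exact: smooth_cis_curve.
  by rewrite derive1_cis_curve0 YE !mulmxA.
have [_ /(_ t _ tan)] := c_geodesic.
rewrite dotmx_trace ofCK adjM mulmxA mxtrace_mulC mulmxA -/(G2 t).
(* The pairing of G'' with G X' becomes Re tr((X' - H) adj X') with H Hermitian; the H term vanishes
   and the squared norm of X' is left. *)
have -> : adj (G t) *m G2 t = X' t - adj (G1 t) *m G1 t.
  by rewrite /X' addrC addKr.
have HH : adj (adj (G1 t) *m G1 t) = adj (G1 t) *m G1 t by rewrite adjM adjK.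
have := Re_trace_herm_skew HH (X'_skew t).
rewrite X'_skew; move: (X' t) (adj (G1 t) *m G1 t) (X'_skew t) => S H SS HS0.
rewrite mulmxN mulmxBl opprB raddfB /= cReD cReN HS0 add0r => tr0.
have : ofC S = 0.
  by apply: dotmx_eq0; rewrite dotmx_trace ofCK SS mulmxN raddfN /= cReN.
move=> /(congr1 (@toC R N)); rewrite ofCK => ->.
by apply/matrixP => i j; rewrite !mxE.
Qed.

(** Constancy of [X] makes the derivative of G(s + a) adj G(s) zero, so this product has the same
    value at [s = b] and at [s = 0]. *)
Lemma geodesic_translation (a b : R) :
  toC (c (a + b)) = toC (c a) *m adj (toC (c 0)) *m toC (c b).
Proof.
have XE t : X t = X 0.
  by apply: is_mxderive0_cst => s; rewrite -(X'_eq0 s); exact: dX.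
have dGa t : is_mxderive (fun s => G (s + a)) t (G1 (t + a)).
  exact: is_derive_translate (dG (t + a)).
have dGG t : is_mxderive (fun s => G (s + a) *m adj (G s)) t 0.
  rewrite (_ : 0 = G1 (t + a) *m adj (G t) + G (t + a) *m adj (G1 t)).
    exact: is_mxderiveM (dGa t) (is_mxderive_adj (dG t)).
  by rewrite !G1E adjM X_skew (XE (t + a)) -(XE t) mulNmx mulmxN mulmxA subrr.
have := is_mxderive0_cst dGG b 0; rewrite add0r [b + a]addrC => GE.
by rewrite -[LHS]mulmx1 -(unitary_adj_mul (GU b)) mulmxA GE.
Qed.

End Geodesics.

(** Translation by 1/2 from the midpoint A gives - J_k = A adj(J_k) A. For [k = 0] this is A A = -1.
    Otherwise adj(J_k) = - J_k, so J_k = A J_k A, and multiplying by A on the right yields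
    anticommutation. *)
Lemma geodesic_midpoint (k : nat) (C : set (cmat R N)) (c : R -> cmat R N) :
  ((0 < k)%N -> J k *m J k = - 1%:M) -> J 0%N = 1%:M -> J k \is unitarymx ->
  is_component (bott k) C ->
  geodesic_from_to C (ofC (J k)) (- ofC (J k)) c -> bott k.+1 (c 2^-1).
Proof.
move=> J2 J0 JU C_comp [cg c0 c1]; set A := toC (c 2^-1).
have [AU A2 AJ] : bott_set k A.
  by case: cg C_comp => -[cC _] _ [x0 _ CE]; have := cC 2^-1; rewrite CE => /connected_component_sub.
have mid : - J k = A *m adj (J k) *m A.
  have half : 2^-1 + 2^-1 = 1 :> R by rewrite [RHS]splitr div1r.
  have := geodesic_translation C_comp cg 2^-1 2^-1.
  by rewrite half c1 c0 toCN !ofCK.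
case: k => [|k] in J2 JU mid A2 AJ C_comp c0 c1 *.
  rewrite J0 adj1 mulmx1 in mid.
  by split; [exact: AU | move=> _; exact: esym | case].
have {}mid : A *m J k.+1 = - (J k.+1 *m A).
  move: mid; rewrite (square_oppr1_adj JU (J2 isT)) mulmxN mulNmx.
  move=> /oppr_inj/(congr1 (mulmx^~ A)) ->.
  by rewrite -!mulmxA (A2 isT) !mulmxN mulmx1 opprK.
split; [exact: AU | exact: A2 | move=> i /andP[i0]].
by rewrite ltnS leq_eqVlt => /orP[/eqP->|ik]; [exact: mid | apply: AJ; rewrite i0].
Qed.

End BottSets.
(** * Centrosomes *)

(** A connected subset of [B] through [x] is connected in [A], hence stays in [C]. This replaces the
    recursive description of a chain (component of a slice of the preceding term) by a component of
    a set defined outright. *)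
Lemma component_setI (R : realType) (V : normedModType R) (A B C : set V) (x : V) :
  B `<=` A -> is_component A C -> B x -> C x ->
  connected_component (C `&` B) x = connected_component B x.
Proof.
move=> BA [x0 _ CE] Bx Cx; apply/seteqP; split.
  apply: connected_component_max; first exact: connected_component_refl.
    by apply: subset_trans (@connected_component_sub _ _ _) _ => y [].
  exact: component_connected.
apply: connected_component_max; first exact: connected_component_refl.
  rewrite subsetI; split; last exact: connected_component_sub.
  have -> : C = connected_component A x.
    by rewrite CE; apply: same_connected_component; rewrite -CE.
  apply: connected_component_max; first exact: connected_component_refl.
    by apply: subset_trans (@connected_component_sub _ _ _) BA.
  exact: component_connected.
exact: component_connected.
Qed.

Section Centrosome.
Variables (R : realType) (N : nat) (J : nat -> 'M[R[i]]_N).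

Lemma unitary_connected : connected (Ugrp R N).
Proof.
have U1 : Ugrp R N (ofC 1%:M) by rewrite /Ugrp /= ofCK; apply/unitaryP; rewrite adj1 mulmx1.
suff -> : Ugrp R N = connected_component (Ugrp R N) (ofC 1%:M).
  exact: component_connected.
apply/seteqP; split; last exact: connected_component_sub.
move=> z zU; have [P [y [PU zE]]] := unitary_spectral zU.
pose e s := ofC (cis_curve (adj P) P y s).
have e1 : e 1 = z.
  have cE : cis_curve (adj P) P y 1 = toC z.
    rewrite zE /cis_curve; congr (_ *m diag_mx _ *m _).
    by apply/rowP => j; rewrite !mxE mulr1.
  by rewrite /e cE toCK.
rewrite -e1; apply: (@component_curve _ _ (Ugrp R N) _ e 0).
- by rewrite /e (cis_curve0 y PU).
- exact: continuous_cis_curve.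
- by move=> s; rewrite /Ugrp /= ofCK; exact: cis_curve_unitary.
Qed.

(** Unitary matrices lie on a sphere for [dotmx], so the position vector is normal. A curve whose
    second derivative is a multiple of its position, such as [quarter_turn], is therefore a
    geodesic. *)
Lemma tangent_unitary_orthogonal (C : set (cmat R N)) z w :
  C `<=` Ugrp R N -> tangent C z w -> Defs.dotmx z w = 0.
Proof.
move=> CU [a [[aC da] a0 a1]].
have dA := is_mxderive_toC (da 0%N 0).
have dAA := is_mxderiveM dA (is_mxderive_adj dA).
have d0 : is_mxderive (fun s => toC (a s) *m adj (toC (a s))) 0 0.
  rewrite (_ : (fun s => _) = fun=> 1%:M); first exact: is_mxderive_cst.
  by apply: funext => s; apply: unitary_mul_adj; exact: CU.
have := congr1 (fun M => complex.Re (\tr M)) (is_mxderive_unique dAA d0).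
rewrite /= a1 a0 mxtraceD mxtrace0 cReD -trace_adj adjM adjK -dotmx_trace.
by rewrite -mulr2n => /eqP; rewrite mulrn_eq0 => /eqP.
Qed.

(** The curve through [a] at 0, [b] at 1/2 and [- a] at 1. It is a [trig_sum] with one term, which
    supplies its smoothness. *)
Definition quarter_turn (a b : cmat R N) : R -> cmat R N :=
  trig_sum (fun=> pi : R) (fun _ : 'I_1 => a) (fun=> b).

Lemma quarter_turnE a b s :
  quarter_turn a b s = cos (pi * s) *: a + sin (pi * s) *: b.
Proof. by rewrite /quarter_turn /trig_sum big_ord1. Qed.

Lemma derive1n2_quarter_turn a b s :
  derive1n 2 (quarter_turn a b) s = - (pi ^+ 2) *: quarter_turn a b s.
Proof.
rewrite derive1nS derive1n1 /quarter_turn !derive1_trig_sum /trig_sum.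
rewrite !big_ord1 scalerDr !scalerA; congr (_ *: _ + _ *: _).
  ring.
ring.
Qed.

Hypothesis J0 : J 0%N = 1%:M.

Lemma quarter_turn_bott k (a b : cmat R N) s :
  toC a = J k -> bott J k a -> bott J k.+1 b -> bott J k (quarter_turn a b s).
Proof.
rewrite /bott /= => aE; set A := toC a; set B := toC b => -[AU A2 AJ] [BU B2 BJ].
rewrite quarter_turnE toCD !toCZ -/A -/B.
set x := (cos _)%:C%C; set y := (sin _)%:C%C.
have xy1 : x * x + y * y = 1 by rewrite -!rmorphM -rmorphD -!expr2 cos2Dsin2.
have conjx : Num.conj x = x by apply: complex_eqP; rewrite ?cRe_conj ?cIm_conj //= oppr0.
have conjy : Num.conj y = y by apply: complex_eqP; rewrite ?cRe_conj ?cIm_conj //= oppr0.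
have adjB := square_oppr1_adj BU (B2 isT).
have BA : (0 < k)%N -> B *m A = - (A *m B).
  by move=> k0; rewrite /A aE; apply: BJ; rewrite k0 ltnS leqnn.
(* For [k = 0], [A] is the identity and [B] is skew; for [k > 0] both are skew and they anticommute.
   Without cross terms, unitarity and the square -1 follow from cos^2 + sin^2 = 1. *)
have cross : A *m adj B + B *m adj A = 0.
  case: (posnP k) => [k0|k0].
    by rewrite /A aE k0 J0 adj1 adjB mul1mx mulmx1 addNr.
  by rewrite adjB (square_oppr1_adj AU (A2 k0)) !mulmxN (BA k0) opprK addNr.
have expand (M M' : 'M[R[i]]_N) :
    (x *: A + y *: B) *m (x *: M + y *: M') =
    (x * x) *: (A *m M) + (y * y) *: (B *m M') + (x * y) *: (A *m M' + B *m M).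
  rewrite mulmxDl !mulmxDr -!scalemxAl -!scalemxAr !scalerA scalerDr [y * x]mulrC.
  have addr_swap (a1 a2 a3 a4 : 'M[R[i]]_N) :
      a1 + a2 + (a3 + a4) = a1 + a4 + (a2 + a3) by rewrite (addrC a3) addrACA.
  exact: addr_swap.
split.
- apply/unitaryP; have -> : adj (x *: A + y *: B) = x *: adj A + y *: adj B.
    by rewrite adjD /adj !linearZ /= !map_mxZ /= conjx conjy.
  rewrite expand cross scaler0 addr0 (unitary_mul_adj AU) (unitary_mul_adj BU).
  by rewrite -scalerDl xy1 scale1r.
- move=> k0; rewrite expand (BA k0) subrr scaler0 addr0 (A2 k0) (B2 isT).
  by rewrite -scalerDl xy1 scale1r.
- move=> i ik; have ik1 : (0 < i < k.+1)%N.
    by case/andP: ik => -> /ltnW; rewrite ltnS.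
  rewrite mulmxDl mulmxDr -!scalemxAl -!scalemxAr (AJ i ik) (BJ i ik1).
  by rewrite !scalerN opprD.
Qed.

Lemma bott_sub_unitary k : bott J k `<=` Ugrp R N.
Proof. by move=> z []. Qed.

Lemma bottS k : bott J k.+1 `<=` bott J k.
Proof.
move=> z [zU z2 zJ]; split=> // [_|i /andP[i0 /ltnW ik]]; first exact: z2.
by apply: zJ; rewrite i0 ltnS.
Qed.

Lemma centrosome_bott k (C : set (cmat R N)) (o : cmat R N) :
  toC o = J k -> is_component (bott J k) C -> C o ->
  centrosome C o (- o) = C `&` bott J k.+1.
Proof.
move=> oE C_comp Co; have CQ : C `<=` bott J k.
  by case: C_comp => x0 _ ->; exact: connected_component_sub.
have [JU J2 _] := CQ _ Co; rewrite oE in JU J2.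
have oE' : o = ofC (J k) by rewrite -oE toCK.
apply/seteqP; split=> [_ [c cg <-]|z [Cz zQ]].
  split; first by case: cg => [[[cC _] _] _ _].
  by rewrite oE' in cg; exact: (geodesic_midpoint J2 J0 JU C_comp cg).
have e0 : quarter_turn o z 0 = o.
  by rewrite quarter_turnE mulr0 cos0 sin0 scale1r scale0r addr0.
have eC s : C (quarter_turn o z s).
  have [x0 _ CE] := C_comp; apply: (@component_curve _ _ (bott J k) C _ 0).
  - by rewrite e0 CE; apply: same_connected_component; rewrite -CE.
  - exact: continuous_trig_sum.
  - by move=> u; exact: (quarter_turn_bott u oE (CQ _ Co) zQ).
exists (quarter_turn o z); last first.
  by rewrite quarter_turnE cos_pihalf sin_pihalf scale0r scale1r add0r.
split=> //; last by rewrite quarter_turnE mulr1 cospi sinpi scale0r addr0 scaleN1r.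
split; first by split=> // j t; exact: derivable_trig_sum.
move=> t w tw; rewrite derive1n2_quarter_turn dotmx_trace toCZ -scalemxAl mxtraceZ.
rewrite cReM /= mul0r subr0 -dotmx_trace.
rewrite (tangent_unitary_orthogonal (subset_trans CQ (@bott_sub_unitary k)) tw).
by rewrite mulr0.
Qed.

End Centrosome.
(** * The Bott chains *)

Section Chains.
Variables (R : realType) (n : nat).
Variables (J : nat -> 'M[R]_(16 * n)) (P : nat -> set 'M[R]_(16 * n)).
Variable Pt : nat -> set (cmat R (16 * n)).
Hypotheses (P_chain : SO_Bott_chain J P) (Pt_chain : U_Bott_chain J Pt).

Definition real_bott (k : nat) : set 'M[R]_(16 * n) :=
  [set A | [/\ SO R (16 * n) A, A *m A = - 1%:M &
               forall i, (0 < i < k)%N -> A *m J i = - (J i *m A)]].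

Lemma SO_chain_component k : (0 < k <= 8)%N -> is_component (real_bott k) (P k).
Proof.
have [_ P1 _ PS] := P_chain.
elim: k => [//|[_ _|k IHk k8]].
  rewrite (_ : real_bott 1 = [set A | SO R (16 * n) A /\ A *m A = - 1%:M]) //.
  apply/seteqP; split=> A /= [AS A2] //.
  by split=> // -[].
move: k8 => /andP[_ k8]; have kk : (0 < k.+1 <= 7)%N by [].
have PkC : is_component (real_bott k.+1) (P k.+1) by apply: IHk; rewrite /= ltnW.
have [[x [Px xJ] PE] _] := PS k.+1 kk.
have PkQ : P k.+1 `<=` real_bott k.+1.
  by case: PkC => y _ ->; exact: connected_component_sub.
(* Points of [P k.+1] already satisfy the earlier relations, so the only new one is anticommutation
   with the last base point. *)
have bottI : [set A | P k.+1 A /\ A *m J k.+1 = - (J k.+1 *m A)] =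
    P k.+1 `&` real_bott k.+2.
  apply/seteqP; split=> A [PA].
    move=> AJ; split=> //; have [AS A2 AJ'] := PkQ _ PA.
    split=> // i /andP[i0]; rewrite ltnS leq_eqVlt => /orP[/eqP->//|ik].
    by apply: AJ'; rewrite i0.
  by case=> _ _ AJ; split=> //; apply: AJ; rewrite ltnSn.
have [_ xQ] : (P k.+1 `&` real_bott k.+2) x by rewrite -bottI; split.
exists x => //; rewrite PE bottI; apply: component_setI PkC xQ Px.
move=> A [AS A2 AJ]; split=> // i /andP[i0 ik]; apply: AJ.
by rewrite i0 ltnW.
Qed.

Lemma SO_chain_base k : (0 < k <= 7)%N -> real_bott k (J k).
Proof.
move=> /[dup] k7 /andP[k0 k7']; have [_ _ PJ _] := P_chain.
have [x _ PE] : is_component (real_bott k) (P k).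
  by apply: SO_chain_component; rewrite k0 ltnW.
by have := PJ k k7; rewrite PE => /connected_component_sub.
Qed.

Let Jc i : 'M[R[i]]_(16 * n) := toC (emb (J i)).

Lemma U_chain_component k : (k <= 8)%N -> is_component (bott Jc k) (Pt k).
Proof.
have [Pt0 PtS] := Pt_chain; have [[_ J0] _ _ _] := P_chain.
have Jc0 : Jc 0%N = 1%:M by rewrite /Jc J0 toC_emb map_mx1.
elim: k => [_|k IHk k8].
  have bott0 : bott Jc 0 = Ugrp R (16 * n).
    by apply/seteqP; split=> [z []//|z zU]; split=> // i; rewrite ltn0 andbF.
  exists (ofC 1%:M); rewrite bott0 ?Pt0.
    by rewrite /Ugrp /= ofCK; apply/unitaryP; rewrite adj1 mulmx1.
  rewrite connected_component_id //; last exact: unitary_connected.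
  by rewrite /Ugrp /= ofCK; apply/unitaryP; rewrite adj1 mulmx1.
have PkC : is_component (bott Jc k) (Pt k) by apply: IHk; exact: ltnW.
(* [PtJ] is the clause of [pole] that puts the base point into [Pt k], as [centrosome_bott]
   requires. *)
have [[[[PtJ _ _ _] [x + PE]] _] _] := PtS k k8.
rewrite (centrosome_bott Jc0 _ PkC PtJ) // => -[Px xQ].
exists x => //; rewrite PE (centrosome_bott Jc0 _ PkC PtJ) //.
by apply: component_setI PkC xQ Px; exact: bottS.
Qed.

End Chains.
(** * Clifford algebra and a primitive idempotent *)

Section CliffordWords.
Variables (A : pzRingType) (m : nat) (e : nat -> A).
Hypothesis e_sqr : forall i, (i < m)%N -> e i * e i = -1.
Hypothesis e_anti : forall i j, (i < m)%N -> (j < m)%N -> i != j ->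
  e i * e j = - (e j * e i).

Definition word (s : seq nat) : A := foldr (fun i x => e i * x) 1 s.

(** The boolean is a sign: passing a different letter flips it, and a pair of equal letters cancels
    to -1. *)
Fixpoint insert_letter (i : nat) (s : seq nat) : bool * seq nat :=
  if s is j :: s' then
    if (i < j)%N then (false, i :: s)
    else if i == j then (true, s')
    else let bt := insert_letter i s' in (~~ bt.1, j :: bt.2)
  else (false, [:: i]).

(* Sign and sorted square-free form of a word in the generators. *)
Fixpoint normal_word (s : seq nat) : bool * seq nat :=
  if s is i :: s' then
    let bt := normal_word s' in let cu := insert_letter i bt.2 in
    (bt.1 (+) cu.1, cu.2)
  else (false, [::]).

Local Notation letters := (all (fun i => (i < m)%N)).

Lemma word_cat s t : word (s ++ t) = word s * word t.
Proof. by elim: s => [|i s IHs] /=; rewrite ?mul1r // IHs mulrA. Qed.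

Lemma word1 i : word [:: i] = e i.
Proof. exact: mulr1. Qed.

Lemma insert_letterP i s : (i < m)%N -> letters s ->
  letters (insert_letter i s).2 /\
  e i * word s = (-1) ^+ (insert_letter i s).1 * word (insert_letter i s).2.
Proof.
move=> im; elim: s => [|j s IHs] /= => [_|/andP[jm sm]].
  by rewrite im expr0 mul1r.
case: ltnP => [_|_] /=; first by rewrite im jm sm expr0 mul1r.
have [->|ij] := eqVneq i j; first by rewrite sm mulrA e_sqr // expr1.
have [tm E] := IHs sm; split=> /=; first by rewrite jm.
rewrite mulrA e_anti // mulNr -mulrA E.
by case: (insert_letter i s).1; rewrite ?expr1 ?expr0 ?mulN1r ?mul1r ?mulrN ?opprK.
Qed.

Lemma normal_wordP s : letters s ->
  letters (normal_word s).2 /\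
  word s = (-1) ^+ (normal_word s).1 * word (normal_word s).2.
Proof.
elim: s => [|i s IHs] /= => [_|/andP[im sm]]; first by rewrite mulr1.
have [tm ->] := IHs sm; have [um E] := insert_letterP im tm; split=> //.
by rewrite mulrA (commr_sign (e i)) -mulrA E mulrA -signr_addb.
Qed.

(** For closed words the premise on [normal_word] holds by evaluation, so each commutation rule
    between the [T], [K] and [w] below costs one computation. *)
Lemma word_comm s t b : letters s -> letters t ->
  normal_word (s ++ t) =
    (b (+) (normal_word (t ++ s)).1, (normal_word (t ++ s)).2) ->
  word s * word t = (-1) ^+ b * (word t * word s).
Proof.
move=> sm tm nE; rewrite -!word_cat.
have stm : letters (s ++ t) by rewrite all_cat sm.
have tsm : letters (t ++ s) by rewrite all_cat sm tm.
have [_ ->] := normal_wordP stm; have [_ ->] := normal_wordP tsm.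
by rewrite nE mulrA -signr_addb.
Qed.

Lemma word_sqr s b : letters s -> normal_word (s ++ s) = (b, [::]) ->
  word s * word s = (-1) ^+ b.
Proof.
move=> sm nE; rewrite -word_cat.
have ssm : letters (s ++ s) by rewrite all_cat sm.
have [_ ->] := normal_wordP ssm.
by rewrite nE /= mulr1.
Qed.

End CliffordWords.

Section PrimitiveIdempotent.
Variables (A : pzRingType) (h : A) (e : nat -> A).
Hypotheses (h2 : h + h = 1) (h_central : forall x, h * x = x * h).
Hypothesis e_sqr : forall i, (i < 8)%N -> e i * e i = -1.
Hypothesis e_anti : forall i j, (i < 8)%N -> (j < 8)%N -> i != j ->
  e i * e j = - (e j * e i).
Implicit Types K T x y : A.

Lemma eq_opp0 x : x = - x -> x = 0.
Proof.
move=> xN; have xx : x + x = 0 by rewrite {1}xN addNr.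
by rewrite -[x]mul1r -h2 mulrDl -mulrDr xx mulr0.
Qed.

(** With [h] one half and [T] an involution, this is the projection onto the +1 eigenspace of
    [T]. *)
Definition proj T : A := h * (1 + T).

(** When [K * K = -1] the inverse of [K] is [- K], so this is [x] plus its conjugate by [K]. *)
Definition spread1 K x : A := x - K * x * K.

Lemma mul_proj T : T * T = 1 -> T * proj T = proj T.
Proof. by move=> T2; rewrite mulrA -h_central -mulrA mulrDr mulr1 T2 addrC. Qed.

Lemma proj_comm T x : x * T = T * x -> x * proj T = proj T * x.
Proof.
by move=> xT; rewrite mulrA -h_central -!mulrA mulrDr mulrDl mulr1 mul1r xT.
Qed.

Lemma proj_anti T x : x * T = - (T * x) -> x * proj T = proj (- T) * x.
Proof.
by move=> xT; rewrite mulrA -h_central -!mulrA mulrDr mulrDl mulr1 mul1r xT mulNr.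
Qed.

Lemma proj_sum T : proj T + proj (- T) = 1.
Proof. by rewrite -mulrDr addrACA subrr addr0 mulrDr mulr1. Qed.

Lemma proj_mul T x : T * x = x -> proj T * x = x.
Proof. by move=> Tx; rewrite -mulrA mulrDl mul1r Tx mulrDr -mulrDl h2 mul1r. Qed.

Lemma spread1_proj K T : K * K = -1 -> K * T = - (T * K) ->
  spread1 K (proj T) = 1.
Proof.
move=> K2 KT; rewrite /spread1 (proj_anti KT) -mulrA K2 mulrN1 opprK.
exact: proj_sum.
Qed.

Lemma spread1_self K x : K * K = -1 -> K * spread1 K x = spread1 K x * K.
Proof.
move=> K2; rewrite /spread1 mulrBr mulrBl !mulrA K2 mulN1r -(mulrA _ K K) K2.
by rewrite mulrN1 !opprK mulNr opprK addrC.
Qed.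

(** Moving [y] across [K * x * K] meets [K] twice, so the sign cancels. *)
Lemma spread1_comm K y x b : y * K = (-1) ^+ b * (K * y) -> y * x = x * y ->
  y * spread1 K x = spread1 K x * y.
Proof.
move=> yK yx; rewrite /spread1 mulrBr mulrBl yx; congr (_ - _).
rewrite !mulrA yK -!mulrA (mulrA y x) yx -mulrA yK.
rewrite (mulrA x) (commr_sign x b) -(mulrA _ x) (mulrA K) (commr_sign K b).
by rewrite -(mulrA _ K) mulrA -expr2 sqrr_sign mul1r.
Qed.

Lemma spread1_fix K T x : T * K = K * T -> T * x = x ->
  T * spread1 K x = spread1 K x.
Proof. by move=> TK Tx; rewrite /spread1 mulrBr Tx !mulrA TK -(mulrA K) Tx. Qed.

Lemma spread1Ml K x y : x * K = K * x -> spread1 K (x * y) = x * spread1 K y.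
Proof. by move=> xK; rewrite /spread1 mulrBr !mulrA xK. Qed.

Lemma spread1Mr K x y : y * K = K * y -> spread1 K (x * y) = spread1 K x * y.
Proof. by move=> yK; rewrite /spread1 mulrBl -!mulrA yK. Qed.

(** [K] carries the +1 eigenspace of [T] into the -1 eigenspace, on which [q] vanishes. *)
Lemma mul_anti_eq0 q K T y : q * T = q -> K * T = - (T * K) -> T * y = y ->
  q * (K * y) = 0.
Proof.
move=> qT KT Ty; apply: eq_opp0.
by rewrite -{1}Ty (mulrA K) KT mulNr mulrN -mulrA (mulrA q) qT.
Qed.

Lemma mul_spread1 q K T y : q * T = q -> K * T = - (T * K) -> T * y = y ->
  q * spread1 K y = q * y.
Proof.
move=> qT KT Ty; rewrite /spread1 mulrBr (mulrA q) (mul_anti_eq0 qT KT Ty).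
by rewrite mul0r subr0.
Qed.

Local Notation word := (word e).

Lemma word_comm8 s t b :
  all (fun i => (i < 8)%N) s -> all (fun i => (i < 8)%N) t ->
  normal_word (s ++ t) =
    (b (+) (normal_word (t ++ s)).1, (normal_word (t ++ s)).2) ->
  word s * word t = (-1) ^+ b * (word t * word s).
Proof. exact: word_comm. Qed.

Lemma word_comm_even s t :
  all (fun i => (i < 8)%N) s -> all (fun i => (i < 8)%N) t ->
  normal_word (s ++ t) = normal_word (t ++ s) ->
  word s * word t = word t * word s.
Proof.
move=> sm tm nE; rewrite (@word_comm8 s t false) //; first exact: mul1r.
by rewrite nE; case: normal_word.
Qed.

Lemma word_comm_odd s t :
  all (fun i => (i < 8)%N) s -> all (fun i => (i < 8)%N) t ->
  normal_word (s ++ t) =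
    (~~ (normal_word (t ++ s)).1, (normal_word (t ++ s)).2) ->
  word s * word t = - (word t * word s).
Proof. by move=> sm tm nE; rewrite (@word_comm8 s t true) // expr1 mulN1r. Qed.

(* T1, T2, T3 and w are commuting involutions; K_i anticommutes with T_i and
   commutes with the other ones.  Together they generate the Clifford group of
   e 0, ..., e 6, which is why an element that commutes with all of them lies
   in the commutant.  The letters are shifted by one: e i stands for J_(i+1). *)
Let T1 := word [:: 0; 1; 2]%N.
Let T2 := word [:: 0; 3; 4]%N.
Let T3 := word [:: 1; 3; 5]%N.
Let w := word [:: 0; 1; 2; 3; 4; 5; 6]%N.
Let K1 := word [:: 2; 6]%N.
Let K2 := word [:: 4; 6]%N.
Let K3 := word [:: 5; 6]%N.
Let j := e 7.

Definition prim : A := proj T1 * (proj T2 * (proj T3 * proj w)).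

(** The sum of the conjugates of [x] by the eight products of [K1], [K2], [K3]. For [x] in the
    corner cut out by [prim], they sit on the eight joint eigenspaces with [w = 1]. *)
Definition spread x : A := spread1 K1 (spread1 K2 (spread1 K3 x)).

Let word_involution s : all (fun i => (i < 8)%N) s ->
  normal_word (s ++ s) = (false, [::]) -> word s * word s = 1.
Proof. by move=> sm nE; rewrite (word_sqr e_sqr e_anti sm nE) expr0. Qed.

Let word_square s : all (fun i => (i < 8)%N) s ->
  normal_word (s ++ s) = (true, [::]) -> word s * word s = -1.
Proof. by move=> sm nE; rewrite (word_sqr e_sqr e_anti sm nE) expr1. Qed.

Let T1T1 : T1 * T1 = 1. Proof. exact: word_involution. Qed.
Let T2T2 : T2 * T2 = 1. Proof. exact: word_involution. Qed.
Let T3T3 : T3 * T3 = 1. Proof. exact: word_involution. Qed.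
Let ww : w * w = 1. Proof. exact: word_involution. Qed.
Let K1K1 : K1 * K1 = -1. Proof. exact: word_square. Qed.
Let K2K2 : K2 * K2 = -1. Proof. exact: word_square. Qed.
Let K3K3 : K3 * K3 = -1. Proof. exact: word_square. Qed.
Let K1T1 : K1 * T1 = - (T1 * K1). Proof. exact: word_comm_odd. Qed.
Let K2T2 : K2 * T2 = - (T2 * K2). Proof. exact: word_comm_odd. Qed.
Let K3T3 : K3 * T3 = - (T3 * K3). Proof. exact: word_comm_odd. Qed.

Lemma mul_T1_prim : T1 * prim = prim.
Proof. by rewrite /prim mulrA mul_proj. Qed.

Lemma mul_T2_prim : T2 * prim = prim.
Proof.
by rewrite /prim mulrA (proj_comm (word_comm_even _ _ _)) // -mulrA (mulrA T2) mul_proj.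
Qed.

Lemma mul_T3_prim : T3 * prim = prim.
Proof.
rewrite /prim mulrA (proj_comm (word_comm_even _ _ _)) // -mulrA (mulrA T3).
by rewrite (proj_comm (word_comm_even _ _ _)) // -mulrA (mulrA T3) mul_proj.
Qed.

Lemma mul_w_prim : w * prim = prim.
Proof.
rewrite /prim mulrA (proj_comm (word_comm_even _ _ _)) // -mulrA (mulrA w).
rewrite (proj_comm (word_comm_even _ _ _)) // -mulrA (mulrA w).
by rewrite (proj_comm (word_comm_even _ _ _)) // -mulrA mul_proj.
Qed.

Lemma prim_comm x : x * T1 = T1 * x -> x * T2 = T2 * x -> x * T3 = T3 * x ->
  x * w = w * x -> x * prim = prim * x.
Proof.
move=> x1 x2 x3 xw; rewrite /prim mulrA (proj_comm x1) -mulrA (mulrA x).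
rewrite (proj_comm x2) -mulrA (mulrA x) (proj_comm x3) -mulrA (proj_comm xw).
by rewrite !mulrA.
Qed.

Lemma prim_mul_T1 : prim * T1 = prim.
Proof. by rewrite -prim_comm ?mul_T1_prim //; exact: word_comm_even. Qed.

Lemma prim_mul_T2 : prim * T2 = prim.
Proof. by rewrite -prim_comm ?mul_T2_prim //; exact: word_comm_even. Qed.

Lemma prim_mul_T3 : prim * T3 = prim.
Proof. by rewrite -prim_comm ?mul_T3_prim //; exact: word_comm_even. Qed.

Lemma prim_mul_w : prim * w = prim.
Proof. by rewrite -prim_comm ?mul_w_prim //; exact: word_comm_even. Qed.

Lemma prim_idem : prim * prim = prim.
Proof.
have primE x : prim * x = proj T1 * (proj T2 * (proj T3 * (proj w * x))).
  by rewrite /prim !mulrA.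
rewrite primE (proj_mul mul_w_prim) (proj_mul mul_T3_prim).
by rewrite (proj_mul mul_T2_prim) (proj_mul mul_T1_prim).
Qed.

(** Each [spread1 K_i] passes over the factors it commutes with and turns [proj T_i] into
    [proj T_i + proj (- T_i) = 1]; only [proj w] survives. *)
Lemma spread_prim : spread prim = proj w.
Proof.
have comm s t : all (fun i => (i < 8)%N) s -> all (fun i => (i < 8)%N) t ->
    normal_word (t ++ s) = normal_word (s ++ t) ->
    proj (word s) * word t = word t * proj (word s).
  by move=> sm tm nE; rewrite (proj_comm (word_comm_even _ _ _)).
rewrite /spread /prim (@spread1Ml K3); last exact: comm.
rewrite (@spread1Ml K3); last exact: comm.
rewrite (@spread1Mr K3); last exact: comm.
rewrite (spread1_proj K3K3 K3T3) mul1r.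
rewrite (@spread1Ml K2); last exact: comm.
rewrite (@spread1Mr K2); last exact: comm.
rewrite (spread1_proj K2K2 K2T2) mul1r.
rewrite (@spread1Mr K1); last exact: comm.
by rewrite (spread1_proj K1K1 K1T1) mul1r.
Qed.

Section Corner.
Variable x : A.
Hypotheses (px : prim * x = x) (xp : x * prim = x).

Let T1x : T1 * x = x. Proof. by rewrite -px mulrA mul_T1_prim. Qed.
Let T2x : T2 * x = x. Proof. by rewrite -px mulrA mul_T2_prim. Qed.
Let T3x : T3 * x = x. Proof. by rewrite -px mulrA mul_T3_prim. Qed.
Let wx : w * x = x. Proof. by rewrite -px mulrA mul_w_prim. Qed.
Let xT1 : x * T1 = x. Proof. by rewrite -xp -mulrA prim_mul_T1. Qed.
Let xT2 : x * T2 = x. Proof. by rewrite -xp -mulrA prim_mul_T2. Qed.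
Let xT3 : x * T3 = x. Proof. by rewrite -xp -mulrA prim_mul_T3. Qed.
Let xw : x * w = x. Proof. by rewrite -xp -mulrA prim_mul_w. Qed.

(** [prim] absorbs each [T_i], hence annihilates every conjugate moved to another eigenspace. *)
Lemma prim_spread : prim * spread x = x.
Proof.
have T12 : T1 * spread1 K2 (spread1 K3 x) = spread1 K2 (spread1 K3 x).
  do 2!(apply: spread1_fix; first exact: word_comm_even).
  exact: T1x.
have T23 : T2 * spread1 K3 x = spread1 K3 x.
  by apply: spread1_fix T2x; exact: word_comm_even.
rewrite /spread (mul_spread1 prim_mul_T1 K1T1 T12).
by rewrite (mul_spread1 prim_mul_T2 K2T2 T23) (mul_spread1 prim_mul_T3 K3T3 T3x).
Qed.

Lemma mul_w_spread : w * spread x = spread x.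
Proof.
do 3!(apply: spread1_fix; first exact: word_comm_even).
exact: wx.
Qed.

Lemma spread_comm_K1 : K1 * spread x = spread x * K1.
Proof. exact: spread1_self. Qed.

Lemma spread_comm_K2 : K2 * spread x = spread x * K2.
Proof.
apply: (@spread1_comm _ _ _ true); first exact: word_comm8.
exact: spread1_self.
Qed.

Lemma spread_comm_K3 : K3 * spread x = spread x * K3.
Proof.
apply: (@spread1_comm _ _ _ true); first exact: word_comm8.
apply: (@spread1_comm _ _ _ true); first exact: word_comm8.
exact: spread1_self.
Qed.

Lemma spread_comm_T1 : T1 * spread x = spread x * T1.
Proof.
apply: (@spread1_comm _ _ _ true); first exact: word_comm8.
apply: (@spread1_comm _ _ _ false); first exact: word_comm8.
apply: (@spread1_comm _ _ _ false); first exact: word_comm8.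
by rewrite T1x xT1.
Qed.

Lemma spread_comm_T2 : T2 * spread x = spread x * T2.
Proof.
apply: (@spread1_comm _ _ _ false); first exact: word_comm8.
apply: (@spread1_comm _ _ _ true); first exact: word_comm8.
apply: (@spread1_comm _ _ _ false); first exact: word_comm8.
by rewrite T2x xT2.
Qed.

Lemma spread_comm_T3 : T3 * spread x = spread x * T3.
Proof.
apply: (@spread1_comm _ _ _ false); first exact: word_comm8.
apply: (@spread1_comm _ _ _ false); first exact: word_comm8.
apply: (@spread1_comm _ _ _ true); first exact: word_comm8.
by rewrite T3x xT3.
Qed.

Lemma spread_comm_w : w * spread x = spread x * w.
Proof.
do 3!(apply: (@spread1_comm _ _ _ false); first exact: word_comm8).
by rewrite wx xw.
Qed.

Let commutes s := word s * spread x = spread x * word s.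

Let commutes_cat s t : commutes s -> commutes t -> commutes (s ++ t).
Proof.
by rewrite /commutes word_cat => sx tx; rewrite -mulrA tx !mulrA sx.
Qed.

Let commutes_letter i s :
  all (fun i => (i < 8)%N) s -> (normal_word s).2 = [:: i] -> commutes s ->
  commutes [:: i].
Proof.
move=> sm nE; rewrite /commutes.
have [_ ->] := normal_wordP e_sqr e_anti sm; rewrite nE.
case: (normal_word s).1; rewrite ?expr1 ?expr0 !(mulN1r, mul1r).
  by rewrite mulNr mulrN => /oppr_inj.
by [].
Qed.

(** Words commuting with [spread x] are closed under concatenation, so a letter commutes once some
    product of such words reduces to it up to sign. *)
Lemma spread_comm i : (i < 7)%N -> e i * spread x = spread x * e i.
Proof.
have cK1 : commutes [:: 2; 6]%N by exact: spread_comm_K1.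
have cK2 : commutes [:: 4; 6]%N by exact: spread_comm_K2.
have cK3 : commutes [:: 5; 6]%N by exact: spread_comm_K3.
have cT1 : commutes [:: 0; 1; 2]%N by exact: spread_comm_T1.
have cT2 : commutes [:: 0; 3; 4]%N by exact: spread_comm_T2.
have cT3 : commutes [:: 1; 3; 5]%N by exact: spread_comm_T3.
have cw : commutes [:: 0; 1; 2; 3; 4; 5; 6]%N by exact: spread_comm_w.
have c6 : commutes [:: 6]%N.
  (* In this product the letter 6 occurs three times and each of the letters 0 to 5 twice. *)
  have cs := commutes_cat cK1 (commutes_cat cK2 (commutes_cat cK3
    (commutes_cat cT1 (commutes_cat cT2 cT3)))).
  exact: commutes_letter cs.
have c2 : commutes [:: 2]%N by apply: commutes_letter (commutes_cat cK1 c6).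
have c4 : commutes [:: 4]%N by apply: commutes_letter (commutes_cat cK2 c6).
have c5 : commutes [:: 5]%N by apply: commutes_letter (commutes_cat cK3 c6).
have c0 : commutes [:: 0]%N.
  have cs := commutes_cat cw (commutes_cat cT3
    (commutes_cat c2 (commutes_cat c4 c6))).
  exact: commutes_letter cs.
have c1 : commutes [:: 1]%N.
  by apply: commutes_letter (commutes_cat cT1 (commutes_cat c0 c2)).
have c3 : commutes [:: 3]%N.
  by apply: commutes_letter (commutes_cat cT2 (commutes_cat c0 c4)).
have letter k : commutes [:: k] -> e k * spread x = spread x * e k.
  by rewrite /commutes word1.
by case: i => [|[|[|[|[|[|[|//]]]]]]] _; exact: letter.
Qed.

End Corner.

Definition corner x : Prop := prim * x = x /\ x * prim = x.

Lemma comm_word y s : all (fun i => (i < 7)%N) s ->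
  (forall i, (i < 7)%N -> y * e i = e i * y) -> y * word s = word s * y.
Proof.
move=> sm ye; elim: s sm => /= [_|i s IHs /andP[im sm]].
  by rewrite mulr1 mul1r.
by rewrite mulrA (ye i im) -mulrA (IHs sm) mulrA.
Qed.

Lemma prim_comm_commutant y : (forall i, (i < 7)%N -> y * e i = e i * y) ->
  y * prim = prim * y.
Proof. by move=> ye; apply: prim_comm; exact: comm_word. Qed.

Lemma spreadMl y x : (forall i, (i < 7)%N -> y * e i = e i * y) ->
  spread (y * x) = y * spread x.
Proof. by move=> ye; rewrite /spread !spread1Ml //; exact: comm_word. Qed.

(** [spread y] commutes with the [K_i] and can be moved inside [spread x]; there [x * spread y = x *
    prim * spread y = x * y]. *)
Lemma spreadM x y : corner x -> corner y ->
  spread (x * y) = spread x * spread y.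
Proof.
move=> [px xp] [py yp].
have -> : spread x * spread y = spread (x * spread y).
  have ye i : (i < 7)%N -> spread y * e i = e i * spread y.
    by move=> im; rewrite (spread_comm py yp im).
  by rewrite {3}/spread !spread1Mr //; exact: comm_word.
by rewrite -{2}xp -mulrA (prim_spread py).
Qed.

Lemma j_anti i : (i < 7)%N -> j * e i = - (e i * j).
Proof. by move=> i7; apply: e_anti => //; [exact: ltnW | rewrite gtn_eqF]. Qed.

Let jj : j * j = -1. Proof. exact: e_sqr. Qed.

Lemma j_anti_w : j * w = - (w * j).
Proof. by rewrite /j -(word1 e 7); exact: word_comm_odd. Qed.

Lemma proj_w_j : j * proj w = proj (- w) * j.
Proof. exact: proj_anti j_anti_w. Qed.

(** An element anticommuting with the seven letters of [w] anticommutes with [w], so it exchanges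
    the eigenspaces [w = 1] and [w = -1]. The two summands are its two off-diagonal blocks. *)
Definition unfold_corner x y : A := spread x * j + j * spread y.

Section Unfold.
Variables x y : A.
Hypotheses (cx : corner x) (cy : corner y).

Lemma unfold_corner_anti i : (i < 7)%N ->
  unfold_corner x y * e i = - (e i * unfold_corner x y).
Proof.
move: cx cy => [px xp] [py yp] i7.
rewrite /unfold_corner mulrDl (mulrDr (e i)) opprD -!mulrA (j_anti i7) -(spread_comm py yp i7).
by rewrite mulrN !mulrA (spread_comm px xp i7) (j_anti i7) mulNr.
Qed.

Lemma spread_j_spread u v : corner u -> corner v -> spread u * (j * spread v) = 0.
Proof.
move=> [pu up] [pv vp]; apply: (mul_anti_eq0 _ j_anti_w (mul_w_spread pv)).
by rewrite -(spread_comm_w pu up) (mul_w_spread pu).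
Qed.

(** The square of each block vanishes, and the mixed products are [- proj w] and [- proj (- w)]. *)
Lemma unfold_corner_sqr : x * y = prim -> y * x = prim ->
  unfold_corner x y * unfold_corner x y = -1.
Proof.
move=> xy yx; rewrite /unfold_corner mulrDl (mulrDr (spread x * j)) (mulrDr (j * spread y)).
have -> : spread x * j * (spread x * j) = 0.
  by rewrite -mulrA (mulrA j) mulrA (spread_j_spread cx cx) mul0r.
have -> : j * spread y * (j * spread y) = 0.
  by rewrite -mulrA (spread_j_spread cy cy) mulr0.
have -> : spread x * j * (j * spread y) = - proj w.
  rewrite -mulrA (mulrA j) jj mulN1r mulrN -(spreadM cx cy) xy.
  by rewrite spread_prim.
have -> : j * spread y * (spread x * j) = - proj (- w).
  rewrite -mulrA (mulrA (spread y)) -(spreadM cy cx) yx spread_prim.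
  by rewrite mulrA proj_w_j -mulrA jj mulrN1.
by rewrite add0r addr0 -opprD proj_sum.
Qed.

Lemma prim_unfold_corner : prim * unfold_corner x y * j = - x.
Proof.
move: cx cy => [px xp] [py yp].
rewrite /unfold_corner (mulrDr prim) (mulrA prim) (prim_spread px).
rewrite (mul_anti_eq0 prim_mul_w j_anti_w (mul_w_spread py)) addr0.
by rewrite -mulrA jj mulrN1.
Qed.

End Unfold.

Section Fold.
Variable a : A.
Hypothesis ae : forall i, (i < 7)%N -> a * e i = - (e i * a).

Lemma mul_j_comm i : (i < 7)%N -> (a * j) * e i = e i * (a * j).
Proof.
by move=> i7; rewrite -mulrA (j_anti i7) mulrN mulrA (ae i7) mulNr opprK mulrA.
Qed.

Lemma j_mul_comm i : (i < 7)%N -> (j * a) * e i = e i * (j * a).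
Proof.
by move=> i7; rewrite -mulrA (ae i7) mulrN mulrA (j_anti i7) mulNr opprK mulrA.
Qed.

(** [a * j] and [j * a] commute with the seven letters, so [spread] acts only on [prim] and gives
    [proj w]; the two blocks become [a * proj (- w)] and [a * proj w]. *)
Lemma unfold_fold : unfold_corner (- (a * j) * prim) (- (j * a) * prim) = a.
Proof.
have ne y : (forall i, (i < 7)%N -> y * e i = e i * y) ->
    forall i, (i < 7)%N -> - y * e i = e i * - y.
  by move=> ye i i7; rewrite mulNr (ye i i7) mulrN.
rewrite /unfold_corner (spreadMl _ (ne _ mul_j_comm)) (spreadMl _ (ne _ j_mul_comm)).
have E1 : a * j * proj w * j = - (a * proj (- w)).
  by rewrite -(mulrA a j) proj_w_j (mulrA a) -(mulrA (a * _)) jj mulrN1.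
have E2 : j * (j * a * proj w) = - (a * proj w).
  by rewrite (mulrA j (j * a)) (mulrA j j) jj mulN1r mulNr.
rewrite spread_prim !mulNr mulrN E1 E2 !opprK -mulrDr addrC.
by rewrite proj_sum mulr1.
Qed.

End Fold.
End PrimitiveIdempotent.

(** * Anti-involutions and traces on the Clifford words *)

Section InvolutionAndTrace.
Variables (A : pzRingType) (h : A) (e : nat -> A).
Hypotheses (h2 : h + h = 1) (h_central : forall x, h * x = x * h).
Hypothesis e_sqr : forall i, (i < 8)%N -> e i * e i = -1.
Hypothesis e_anti : forall i j, (i < 8)%N -> (j < 8)%N -> i != j ->
  e i * e j = - (e j * e i).

Let letters := all (fun i => (i < 8)%N).

Section Involution.
Variable star : A -> A.
Hypotheses (starD : forall x y, star (x + y) = star x + star y)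
  (starM : forall x y, star (x * y) = star y * star x)
  (star1 : star 1 = 1) (star_h : star h = h)
  (star_e : forall i, (i < 8)%N -> star (e i) = - e i).

Let star0 : star 0 = 0.
Proof. by apply: (addrI (star 0)); rewrite -starD !addr0. Qed.

Let starN x : star (- x) = - star x.
Proof. by apply/eqP; rewrite -addr_eq0 -starD addNr star0. Qed.

Lemma star_word s : letters s -> star (word e s) = (-1) ^+ size s * word e (rev s).
Proof.
elim: s => [_|i s IHs /andP[im sm]] /=; first by rewrite star1 mulr1.
rewrite starM (IHs sm) (star_e im) rev_cons -cats1 word_cat word1.
by rewrite exprSr -!mulrA mulN1r !mulrN.
Qed.

Lemma star_word_even s b : letters s ->
  normal_word (rev s) = (b (+) (odd (size s) (+) (normal_word s).1), (normal_word s).2) ->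
  star (word e s) = (-1) ^+ b * word e s.
Proof.
move=> sm nE; rewrite (star_word sm).
have rm : letters (rev s) by rewrite /letters all_rev.
have [_ ->] := normal_wordP e_sqr e_anti rm.
have [_ ->] := normal_wordP e_sqr e_anti sm.
by rewrite nE -(signr_odd _ (size s)) /= !mulrA -!signr_addb addbCA addKb.
Qed.

Lemma star_proj s : letters s ->
  normal_word (rev s) = (odd (size s) (+) (normal_word s).1, (normal_word s).2) ->
  star (proj h (word e s)) = proj h (word e s).
Proof.
move=> sm nE; rewrite /proj starM starD star1 star_h (@star_word_even _ false) //.
by rewrite mul1r h_central.
Qed.

(** [star] fixes each of the four projections and reverses their product, which is harmless because
    they commute. *)
Lemma star_prim : star (prim h e) = prim h e.
Proof.
have comm s t : letters s -> letters t ->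
    normal_word (t ++ s) = normal_word (s ++ t) ->
    proj h (word e s) * proj h (word e t) = proj h (word e t) * proj h (word e s).
  move=> sm tm nE; apply: (proj_comm h_central); apply/esym.
  by apply: (proj_comm h_central); exact: (word_comm_even e_sqr e_anti).
rewrite /prim; set a := proj _ _; set b := proj _ _; set c := proj _ _; set d := proj _ _.
have dc : d * c = c * d by exact: comm.
have db : d * b = b * d by exact: comm.
have da : d * a = a * d by exact: comm.
have cb : c * b = b * c by exact: comm.
have ca : c * a = a * c by exact: comm.
have ba : b * a = a * b by exact: comm.
have sa : star a = a by exact: star_proj.
have sb : star b = b by exact: star_proj.
have sc : star c = c by exact: star_proj.
have sd : star d = d by exact: star_proj.
clearbody a b c d; rewrite !starM sa sb sc sd.
rewrite dc -(mulrA c) db (mulrA c) -(mulrA (c * b)) da cb (mulrA (b * c)).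
by rewrite -(mulrA b) ca (mulrA b) ba -!mulrA.
Qed.

Lemma star_spread x : star (spread e x) = spread e (star x).
Proof.
have starK s y : letters s -> star (word e s) = - word e s ->
    star (spread1 (word e s) y) = spread1 (word e s) (star y).
  move=> sm sE; rewrite /spread1 starD starN !starM sE.
  by rewrite mulrN mulNr mulrN opprK mulrA.
have KE s : letters s -> normal_word (rev s) = (~~ (odd (size s) (+) (normal_word s).1), (normal_word s).2) ->
    star (word e s) = - word e s.
  by move=> sm nE; rewrite (@star_word_even _ true) // expr1 mulN1r.
by rewrite /spread !starK //; exact: KE.
Qed.

End Involution.

Lemma trace_spread (V : zmodType) (tau : A -> V) :
  (forall x y, tau (x + y) = tau x + tau y) ->
  (forall x y, tau (x * y) = tau (y * x)) ->
  forall x, tau (spread e x) = tau x *+ 8.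
Proof.
move=> tauD tauC; have tau0 : tau 0 = 0.
  by apply: (addrI (tau 0)); rewrite -tauD !addr0.
have tauN x : tau (- x) = - tau x.
  by apply/eqP; rewrite -addr_eq0 -tauD addNr tau0.
have tauK s x : letters s -> normal_word (s ++ s) = (true, [::]) ->
    tau (spread1 (word e s) x) = tau x *+ 2.
  move=> sm nE; rewrite /spread1 tauD tauN tauC mulrA (word_sqr e_sqr e_anti sm nE).
  by rewrite expr1 mulN1r tauN opprK.
by move=> x; rewrite /spread !tauK // -!mulrnA.
Qed.

(** The factor is 8 times 2: [spread] adds eight conjugates of equal trace to give [proj w], and
    [e 7] conjugates [proj w] to [proj (- w)]. *)
Lemma trace_prim (V : zmodType) (tau : A -> V) :
  (forall x y, tau (x + y) = tau x + tau y) ->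
  (forall x y, tau (x * y) = tau (y * x)) ->
  tau 1 = tau (prim h e) *+ 16.
Proof.
move=> tauD tauC; rewrite (mulrnA _ 8 2) -(trace_spread tauD tauC).
rewrite (spread_prim h2 h_central e_sqr e_anti).
set w := word _ _; have tau0 : tau 0 = 0.
  by apply: (addrI (tau 0)); rewrite -tauD !addr0.
have tauN x : tau (- x) = - tau x.
  by apply/eqP; rewrite -addr_eq0 -tauD addNr tau0.
rewrite -(proj_sum h2 w) tauD mulr2n; congr (_ + _).
have /(congr1 ( *%R^~ (e 7))) := proj_w_j h_central e_sqr e_anti.
rewrite -/w -[in RHS]mulrA e_sqr // mulrN1 => /(congr1 tau).
by rewrite tauC mulrA e_sqr // mulN1r !tauN => /oppr_inj.
Qed.

End InvolutionAndTrace.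
(** * Orthonormal frames *)

Lemma row_norm_eq1 (R : realType) (N : nat) (v : 'rV[R]_N) : v != 0 ->
  exists2 a : R, a != 0 & (a *: v) *m (a *: v)^T = 1%:M.
Proof.
move=> v0; pose q := \tr (v *m v^T).
have q0 : 0 < q.
  rewrite lt_def trace_mul_tr_ge0 andbT.
  by apply: contra v0 => /eqP/trace_mul_tr_eq0->.
have sq0 : Num.sqrt q != 0 by rewrite gt_eqF // sqrtr_gt0.
exists (Num.sqrt q)^-1; first by rewrite invr_eq0.
rewrite linearZ /= -scalemxAl -scalemxAr scalerA -invfM -expr2 sqr_sqrtr ?ltW //.
apply/matrixP => i j; rewrite !ord1 [LHS]mxE.
have -> : (v *m v^T) 0 0 = q by rewrite /q /mxtrace big_ord1.
by rewrite mulVf ?gt_eqF // mxE eqxx.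
Qed.

(** The trace of an orthogonal projection is its rank. A nonzero row of [p], normalized, is a unit
    vector [e] fixed by [p], and [p - e^T *m e] is a projection of trace one less. *)
Lemma orthonormal_frame (R : realType) (n N : nat) (p : 'M[R]_N) :
  p^T = p -> p *m p = p -> \tr p = n%:R ->
  exists E : 'M[R]_(n, N), E *m E^T = 1%:M /\ E^T *m E = p.
Proof.
elim: n p => [|n IHn] p pT pp trp.
  have p0 : p = 0 by apply: trace_mul_tr_eq0; rewrite pT pp trp.
  exists 0; rewrite mul0mx mulmx0 p0; split=> //.
  by apply/matrixP => -[].
have [i vi0] : exists i, row i p != 0.
  apply/existsP; apply: contraT => /existsPn p0.
  have pz : p = 0 by apply/row_matrixP => i; rewrite row0; apply/eqP; rewrite -[_ == _]negbK.
  by move/eqP: trp; rewrite pz mxtrace0 eq_sym pnatr_eq0.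
have [a a0 ee] := row_norm_eq1 vi0; set e := a *: row i p in ee.
have ep : e *m p = e by rewrite /e -scalemxAl -row_mul pp.
have pe : p *m e^T = e^T by rewrite -{2}ep trmx_mul pT.
clearbody e; pose q := p - e^T *m e.
have qT : q^T = q by rewrite /q linearB /= pT trmx_mul trmxK.
have eq0 : e *m q = 0 by rewrite mulmxBr ep mulmxA ee mul1mx subrr.
have qq : q *m q = q.
  by rewrite {1}/q mulmxBl -(mulmxA e^T) eq0 mulmx0 subr0 /q mulmxBr pp mulmxA pe.
have [|E [EE Eq]] := IHn q qT qq.
  rewrite /q raddfB /= trp mxtrace_mulC ee mxtrace1 -natr1 addrK //.
have Ee : E *m e^T = 0.
  rewrite -[E]mul1mx -EE -!mulmxA (mulmxA E^T) Eq.
  by rewrite -[q]qT -trmx_mul eq0 trmx0 mulmx0.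
rewrite -[n.+1]add1n; exists (col_mx e E); split.
  rewrite tr_col_mx mul_col_row ee EE Ee.
  have -> : e *m E^T = 0 by rewrite -[e]trmxK -trmx_mul Ee trmx0.
  by rewrite scalar_mx_block.
by rewrite tr_col_mx mul_row_col Eq /q addrC subrK.
Qed.
(** * Connectedness of the special orthogonal group *)

Lemma continuous_sumr (R : realType) (T : topologicalType) (W : normedModType R)
    (I : Type) (r : seq I) (F : I -> T -> W) :
  (forall i, continuous (F i)) -> continuous (fun x => \sum_(i <- r) F i x).
Proof.
by move=> Fc; apply: continuous_big => [|i _]; [exact: add_continuous | exact: Fc].
Qed.

Lemma linear_mx_continuous (R : realType) (W : normedModType R) (m n : nat)
    (F : 'M[R]_(m, n) -> W) : linear F -> continuous F.
Proof.
move=> F_lin; have F0 := linear_map0 F_lin; have FD := linear_mapD F_lin.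
have FE : F = fun M => \sum_i \sum_j M i j *: F (delta_mx i j).
  apply: funext => M; rewrite {1}[M]matrix_sum_delta (big_morph F FD F0).
  apply: eq_bigr => i _; rewrite (big_morph F FD F0); apply: eq_bigr => j _.
  exact: linear_mapZ.
rewrite FE; do 2!(apply: continuous_sumr => ?).
by move=> M; apply: continuousZr_tmp; exact: coord_continuous.
Qed.

Lemma linear_cmat_continuous (R : realType) (W : normedModType R) (N : nat)
    (F : cmat R N -> W) : linear F -> continuous F.
Proof.
move=> F_lin.
have FE : F = (fun z => F (z.1, 0)) + (fun z => F (0, z.2)).
  apply: funext => z; rewrite -[RHS](linear_mapD F_lin); congr F.
  by rewrite [LHS]surjective_pairing; congr pair; rewrite /= ?addr0 ?add0r.
have c1 : continuous (fun A : 'M[R]_N => F (A, 0)).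
  apply: linear_mx_continuous => a x y; rewrite -F_lin; congr F.
  by congr pair; rewrite /= scaler0 addr0.
have c2 : continuous (fun A : 'M[R]_N => F (0, A)).
  apply: linear_mx_continuous => a x y; rewrite -F_lin; congr F.
  by congr pair; rewrite /= scaler0 addr0.
rewrite FE => z; apply: continuousD.
  apply: (@continuous_comp _ _ _ fst (fun A : 'M[R]_N => F (A, 0)) z).
    exact: cvg_fst.
  exact: c1.
apply: (@continuous_comp _ _ _ snd (fun A : 'M[R]_N => F (0, A)) z).
  exact: cvg_snd.
exact: c2.
Qed.

Lemma det_continuous (R : realType) (n : nat) : continuous (@determinant R n).
Proof.
have prodc (s : {perm 'I_n}) : continuous (fun M : 'M[R]_n => \prod_i M i (s i)).
  apply: continuous_big => [|i _]; first exact: mul_continuous.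
  exact: coord_continuous.
apply: (@continuous_sumr R _ R^o) => s M.
exact: (@continuousZl_tmp R R^o _ _ ((-1) ^+ s) M (prodc s M)).
Qed.

Section OrthogonalGroup.
Variables (R : realType) (n : nat).
Implicit Types (A B : 'M[R]_n) (u v w : 'rV[R]_n).

Definition orthogonal : set 'M[R]_n := [set A | A *m A^T = 1%:M].

Local Notation joined := (connected_component orthogonal).

Lemma orthogonalM A B : orthogonal A -> orthogonal B -> orthogonal (A *m B).
Proof.
rewrite /orthogonal /= => AO BO.
by rewrite trmx_mul mulmxA -(mulmxA A) BO mulmx1.
Qed.

Lemma det_orthogonal A : orthogonal A -> \det A = 1 \/ \det A = -1.
Proof.
move=> /(congr1 (@determinant R n)); rewrite det_mulmx det_tr det1 -expr2.
by move=> /eqP; rewrite sqrf_eq1 => /orP[/eqP|/eqP] ->; [left | right].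
Qed.

(** By the intermediate value property, passing from 1 to -1 would produce an orthogonal matrix of
    determinant 0. *)
Lemma det_connected (C : set 'M[R]_n) A B :
  connected C -> C `<=` orthogonal -> C A -> C B -> \det A = 1 -> \det B = 1.
Proof.
move=> Cc CO CA CB A1; case: (det_orthogonal (CO _ CB)) => // B1.
have : connected (@determinant R n @` C).
  apply: connected_continuous_connected Cc _; apply: continuous_subspaceT.
  exact: det_continuous.
move=> /connected_intervalP/(_ _ _ (ex_intro2 _ _ _ CB B1) (ex_intro2 _ _ _ CA A1)).
move=> /(_ 0); rewrite lerN10 ler01 => -[//|D CD D0].
by case: (det_orthogonal (CO _ CD)) => /eqP; rewrite D0 eq_sym ?oppr_eq0 oner_eq0.
Qed.

Lemma joined_mulr A A' B : orthogonal B -> joined A A' -> joined (A *m B) (A' *m B).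
Proof.
move=> BO [C [CA CO Cc] CA']; exists (mulmxr B @` C); last by exists A'.
split; first by exists A.
  by move=> _ [M CM <-]; apply: orthogonalM => //; exact: CO.
apply: connected_continuous_connected Cc _; apply: continuous_subspaceT.
by apply: linear_mx_continuous => a x y; rewrite linearP.
Qed.

Lemma joined_mull A A' B : orthogonal B -> joined A A' -> joined (B *m A) (B *m A').
Proof.
move=> BO [C [CA CO Cc] CA']; exists (mulmx B @` C); last by exists A'.
split; first by exists A.
  by move=> _ [M CM <-]; apply: orthogonalM => //; exact: CO.
apply: connected_continuous_connected Cc _; apply: continuous_subspaceT.
by apply: linear_mx_continuous => a x y; rewrite linearP.
Qed.

Definition reflection u : 'M[R]_n := 1%:M - 2 *: (u^T *m u).

Lemma reflection_sym u : (reflection u)^T = reflection u.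
Proof. by rewrite /reflection linearB linearZ /= trmx1 trmx_mul trmxK. Qed.

Lemma reflectionK u : u *m u^T = 1%:M -> reflection u *m reflection u = 1%:M.
Proof.
move=> uu; rewrite {1}/reflection mulmxBl mul1mx -scalemxAl -mulmxA.
have -> : u *m reflection u = - u.
  rewrite mulmxBr mulmx1 -scalemxAr mulmxA uu mul1mx scaler_nat mulr2n.
  by rewrite opprD addrA subrr add0r.
by rewrite mulmxN scalerN opprK subrK.
Qed.

Lemma reflection_orthogonal u : u *m u^T = 1%:M -> orthogonal (reflection u).
Proof. by move=> uu; rewrite /orthogonal /= reflection_sym reflectionK. Qed.

Lemma joined_reflections_perp u w (a b : R) : u *m u^T = 1%:M -> w *m w^T = 1%:M ->
  u *m w^T = 0 -> a ^+ 2 + b ^+ 2 = 1 ->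
  joined (reflection u) (reflection (a *: u + b *: w)).
Proof.
move=> uu ww uw ab1.
have [x abx] : exists x, (a +i* b)%C = cis x.
  apply: cis_onto; apply: complex_eqP => /=; first by rewrite mulrN opprK -!expr2.
  by rewrite mulrN mulrC addNr.
move: abx => [-> ->] {a b ab1}.
have wu : w *m u^T = 0 by rewrite -[w]trmxK -trmx_mul uw trmx0.
pose c s := cos s *: u + sin s *: w.
have cc s : c s *m (c s)^T = 1%:M.
  rewrite /c linearD !linearZ /= mulmxDl !mulmxDr -!scalemxAl -!scalemxAr.
  rewrite uu ww uw wu !scaler0 addr0 add0r !scalerA -scalerDl -!expr2.
  by rewrite cos2Dsin2 scale1r.
have rc : continuous (fun s => reflection (c s)).
  have -> : (fun s => reflection (c s)) = (fun s => 1%:M - 2 *: (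
      (cos s * cos s) *: (u^T *m u) + (cos s * sin s) *: (u^T *m w + w^T *m u)
      + (sin s * sin s) *: (w^T *m w))).
    apply: funext => s; rewrite /reflection /c.
    have -> : (cos s *: u + sin s *: w)^T = cos s *: u^T + sin s *: w^T.
      by rewrite linearD !linearZ.
    rewrite mulmxDl !mulmxDr -!scalemxAl -!scalemxAr !scalerA.
    rewrite (scalerDr (cos s * sin s)).
    by rewrite [sin s * cos s]mulrC !addrA.
  have cosc := @continuous_cos R; have sinc := @continuous_sin R.
  move=> s; rewrite /continuous_at; apply: cvgB; first exact: cvg_cst.
  apply: cvgZl_tmp; apply: cvgD; [apply: cvgD|]; apply: cvgZr_tmp; apply: cvgM;
    exact: cosc || exact: sinc.
exists (range (fun s => reflection (c s))); last by exists x.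
split; first by exists 0; rewrite // /c cos0 sin0 scale1r scale0r addr0.
  by move=> _ [s _ <-]; exact: reflection_orthogonal.
exact: connected_curve.
Qed.

(** Rotate [u] to [v] in the plane they span. If they are proportional then [v] is [u] or [- u], and
    the two reflections coincide. *)
Lemma joined_reflections u v : u *m u^T = 1%:M -> v *m v^T = 1%:M ->
  joined (reflection u) (reflection v).
Proof.
move=> uu vv; pose a := (v *m u^T) 0 0; pose d := v - a *: u.
have va : v *m u^T = a%:M by apply/matrixP => i j; rewrite !ord1 [RHS]mxE eqxx.
have du : d *m u^T = 0.
  by rewrite mulmxBl -scalemxAl uu va scalemx1 subrr.
have vE : v = a *: u + d by rewrite addrC subrK.
have ud : u *m d^T = 0 by rewrite -[u]trmxK -trmx_mul du trmx0.
have [d0|d0] := eqVneq d 0.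
  have -> : reflection v = reflection u; last first.
    exact/connected_component_refl/reflection_orthogonal.
  have a2 : a * a = 1.
    have := vv; rewrite vE d0 addr0 linearZ /= -scalemxAl -scalemxAr uu scalerA.
    by move=> /matrixP/(_ 0 0); rewrite !mxE eqxx mulr1.
  have uTu : (a *: u)^T *m (a *: u) = u^T *m u.
    by rewrite [(a *: u)^T]linearZ /= -scalemxAl -scalemxAr scalerA a2 scale1r.
  by rewrite /reflection vE d0 addr0 uTu.
have [b b0 ww] := row_norm_eq1 d0; set w := b *: d in ww.
have dE : d = b^-1 *: w by rewrite scalerA mulVf // scale1r.
have uw : u *m w^T = 0 by rewrite linearZ /= -scalemxAr ud scaler0.
clearbody w; rewrite vE dE; apply: joined_reflections_perp => //.
have wu : w *m u^T = 0 by rewrite -[w]trmxK -trmx_mul uw trmx0.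
have := vv; rewrite vE dE linearD !linearZ /= mulmxDl !mulmxDr.
rewrite -!scalemxAl -!scalemxAr uu ww uw wu !scaler0 addr0 add0r.
rewrite !scalerA -scalerDl => /matrixP/(_ 0 0).
by rewrite !mxE eqxx mulr1 -!expr2.
Qed.

(* The reflection exchanging v and v A also fixes the vectors fixed by A, so
   that composing with it enlarges the fixed space. *)
Lemma reflection_reduces_rank A : orthogonal A -> A != 1%:M ->
  exists2 u, u *m u^T = 1%:M &
    (\rank (A *m reflection u - 1%:M)%R < \rank (A - 1%:M)%R)%N.
Proof.
move=> AO A1; have /rowV0Pn[v0 /submxP[v v0E] v0N] : A - 1%:M != 0.
  by rewrite subr_eq0.
pose d := v *m A - v; have dE : d = v0 by rewrite v0E mulmxBr mulmx1.
have d0 : d != 0 by rewrite dE.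
have [a a0 uu] := row_norm_eq1 d0; exists (a *: d) => //; set u := a *: d in uu *.
have AA : A *m A^T = 1%:M := AO.
have fixA m (x : 'M[R]_(m, n)) : x *m A = x -> x *m u^T = 0.
  move=> xA; have xAT : x *m A^T = x by rewrite -{1}xA -mulmxA AA mulmx1.
  have -> : u^T = a *: (A^T *m v^T - v^T).
    by rewrite /u [LHS]linearZ /d linearB /= trmx_mul.
  by rewrite -scalemxAr mulmxBr mulmxA xAT subrr scaler0.
have fixR m (x : 'M[R]_(m, n)) : x *m A = x -> x *m (A *m reflection u) = x.
  move=> xA; rewrite mulmxA xA mulmxBr mulmx1 -scalemxAr mulmxA (fixA m x xA).
  by rewrite mul0mx scaler0 subr0.
have fixv : v *m (A *m reflection u) = v.
  (* This holds because [v] and [v *m A] have equal length; it says that reflecting [v *m A] along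
     [d] subtracts exactly [d]. *)
  have dd : d *m d^T = 2 *: (v *m A *m d^T).
    have vAvA : v *m A *m (v *m A)^T = v *m v^T.
      by rewrite trmx_mul mulmxA -(mulmxA v) AA mulmx1.
    have vAv : v *m (v *m A)^T = v *m A *m v^T.
      by rewrite -[LHS]trmxK trmx_mul trmxK; apply/matrixP => i j; rewrite mxE !ord1.
    rewrite {1}/d mulmxBl /d linearB /= !mulmxBr vAvA vAv.
    by rewrite scaler_nat mulr2n opprB.
  have uTu : u^T *m u = (a * a) *: (d^T *m d).
    by rewrite [u^T]linearZ /= -scalemxAl -scalemxAr scalerA.
  have udd : (a * a) *: (d *m d^T) = 1%:M.
    by rewrite -uu linearZ /= -scalemxAl -scalemxAr scalerA.
  rewrite mulmxA mulmxBr mulmx1 uTu -!scalemxAr scalerA [2 * _]mulrC -scalerA.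
  rewrite mulmxA scalemxAl -dd scalemxAl udd mul1mx /d.
  by rewrite opprB addrC subrK.
have kerR : (kermx (A - 1%:M)%R < kermx (A *m reflection u - 1%:M)%R)%MS.
  rewrite ltmxE; apply/andP; split.
    apply/sub_kermxP; rewrite mulmxBr mulmx1 fixR ?subrr //.
    have /eqP := mulmx_ker (A - 1%:M).
    by rewrite mulmxBr mulmx1 subr_eq0 => /eqP.
  apply/negP => /(submx_trans _) kk.
  have /kk/sub_kermxP : (v <= kermx (A *m reflection u - 1%:M)%R)%MS.
    by apply/sub_kermxP; rewrite mulmxBr mulmx1 fixv subrr.
  by rewrite mulmxBr mulmx1 => /eqP; apply/negP.
have := rank_ltmx kerR; rewrite !mxrank_ker.
by move: (rank_leq_row (A - 1%:M)%R); lia.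
Qed.

End OrthogonalGroup.

Section SpecialOrthogonalGroup.
Variables (R : realType) (n : nat).
Implicit Types A B : 'M[R]_n.+1.

Local Notation joined := (connected_component (@orthogonal R n.+1)).

(** A fixed reflection representing determinant -1; the size [n.+1] provides the unit vector. *)
Let s : 'M[R]_n.+1 := reflection (delta_mx 0 0).

Let unit_delta : (delta_mx 0 0 : 'rV[R]_n.+1) *m (delta_mx 0 0)^T = 1%:M.
Proof.
rewrite trmx_delta mul_delta_mx; apply/matrixP => i j.
by rewrite !ord1 !mxE.
Qed.

Let sO : orthogonal s. Proof. exact: reflection_orthogonal unit_delta. Qed.

Let det_s : \det s = -1.
Proof.
have -> : s = diag_mx (\row_j (if j == 0 then -1 else 1)).
  apply/matrixP => i j; rewrite /s /reflection trmx_delta mul_delta_mx !mxE.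
  have [->|ij] := eqVneq i j; rewrite ?mulr1n ?mulr0n.
    case: eqP => _ /=; last by rewrite mulr0 subr0.
    by rewrite mulr1 opprD addrA subrr add0r.
  case: eqP => [i0|_] /=; last by rewrite mulr0 subr0.
  by case: eqP => [j0|_] /=; [rewrite i0 j0 eqxx in ij | rewrite mulr0 subr0].
rewrite det_diag (bigD1 0) //= !mxE /= big1 ?mulr1 // => i i0.
by rewrite mxE (negbTE i0).
Qed.

(** Induction on the rank of [A - 1]: composing with a suitable reflection lowers it, all
    reflections are joined to [s], and multiplication by a reflection exchanges the two
    alternatives. *)
Lemma joined_1_or_reflection A : orthogonal A -> joined 1%:M A \/ joined s A.
Proof.
have [m] := ubnP (\rank (A - 1%:M)%R); elim: m A => // m IHm A Am AO.
have O1 : orthogonal (1%:M : 'M[R]_n.+1) by rewrite /orthogonal /= trmx1 mulmx1.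
have [->|A1] := eqVneq A 1%:M; first by left; exact: connected_component_refl.
have [u uu rk] := reflection_reduces_rank AO A1.
have uO := reflection_orthogonal uu.
have su : joined s (reflection u) by exact: joined_reflections.
have AE : A *m reflection u *m reflection u = A.
  by rewrite -mulmxA reflectionK // mulmx1.
have [j1|js] := IHm (A *m reflection u) (leq_trans rk Am) (orthogonalM AO uO).
  right; have := joined_mulr uO j1; rewrite AE mul1mx.
  exact: connected_component_trans.
left; have := joined_mulr uO js; rewrite AE; apply: connected_component_trans.
have := joined_mull sO su; rewrite /s reflectionK //.
Qed.

Lemma SO_connected : connected (SO R n.+1).
Proof.
have O1 : orthogonal (1%:M : 'M[R]_n.+1) by rewrite /orthogonal /= trmx1 mulmx1.
suff -> : SO R n.+1 = joined 1%:M by exact: component_connected.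
apply/seteqP; split=> A.
  move=> [AO A1]; have [//|sA] := joined_1_or_reflection AO.
  have := @det_connected _ _ _ A s (@component_connected _ (@orthogonal R n.+1) s)
    (@connected_component_sub _ _ _) sA (connected_component_refl sO) A1.
  by rewrite det_s => /eqP; rewrite eqNr oner_eq0.
move=> jA; split; first exact: connected_component_sub jA.
apply: (det_connected (@component_connected _ (@orthogonal R n.+1) 1%:M)
  (@connected_component_sub _ _ _) (connected_component_refl O1) jA).
exact: det1.
Qed.

End SpecialOrthogonalGroup.
(** * Folding and unfolding *)

Section CliffordMorphism.
Variables (A B : pzRingType) (f : A -> B) (h : A) (e : nat -> A).
Hypotheses (fD : forall x y, f (x + y) = f x + f y)
  (fM : forall x y, f (x * y) = f x * f y) (f1 : f 1 = 1).

Let fB x y : f (x - y) = f x - f y.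
Proof.
have f0 : f 0 = 0 by apply: (addrI (f 0)); rewrite -fD !addr0.
rewrite fD; congr (_ + _).
by apply/eqP; rewrite -addr_eq0 -fD addNr f0.
Qed.

Lemma morph_word s : f (word e s) = word (f \o e) s.
Proof. by elim: s => //= i s IHs; rewrite fM IHs. Qed.

(** Meant for the inclusion of real into complex matrices, which carries the real frame to one for
    the complex generators. *)
Lemma morph_prim : f (prim h e) = prim (f h) (f \o e).
Proof.
have fP s : f (proj h (word e s)) = proj (f h) (word (f \o e) s).
  by rewrite /proj fM fD f1 morph_word.
have fM4 a b c d : f (a * (b * (c * d))) = f a * (f b * (f c * f d)).
  by rewrite !fM.
by rewrite /prim fM4 !fP.
Qed.

Lemma morph_spread x : f (spread e x) = spread (f \o e) (f x).
Proof.
have fK s y : f (spread1 (word e s) y) = spread1 (word (f \o e) s) (f y).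
  have fMM a b : f (a * b * a) = f a * f b * f a by rewrite !fM.
  by rewrite /spread1 fB fMM morph_word.
by rewrite /spread !fK.
Qed.

Lemma morph_unfold_corner x y :
  f (unfold_corner e x y) = unfold_corner (f \o e) (f x) (f y).
Proof. by rewrite /unfold_corner fD !fM !morph_spread. Qed.

End CliffordMorphism.

Lemma half_scalar_mx (F : numFieldType) (m : nat) :
  ((2^-1)%:M : 'M[F]_m) + (2^-1)%:M = 1%:M.
Proof.
have half : 2^-1 + 2^-1 = 1 :> F by rewrite [RHS]splitr div1r.
by apply/matrixP => i k; rewrite !mxE -mulrnDl half.
Qed.

Section FoldUnfold.
Variables (R : realType) (n N : nat).
Local Notation C := (R[i]).
Variables (e : nat -> 'M[C]_N) (E : 'M[C]_(n, N)).
Local Notation h := ((2^-1)%:M : 'M[C]_N).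
Local Notation p := (prim h e).
Local Notation j := (e 7).
Hypothesis e_sqr : forall i, (i < 8)%N -> e i *m e i = - 1%:M.
Hypothesis e_anti : forall i k, (i < 8)%N -> (k < 8)%N -> i != k ->
  e i *m e k = - (e k *m e i).
Hypothesis e_adj : forall i, (i < 8)%N -> adj (e i) = - e i.
Hypotheses (EE : E *m adj E = 1%:M) (Ep : adj E *m E = p).

Implicit Types (A X Y : 'M[C]_N) (U V : 'M[C]_n).

Let h2 : h + h = 1. Proof. exact: half_scalar_mx. Qed.

Let h_central (x : 'M[C]_N) : h * x = x * h.
Proof. by rewrite -[LHS]/(h *m x) -[RHS]/(x *m h) mul_scalar_mx mul_mx_scalar. Qed.

(** As [j *m j = -1], the sign sends [A = j] to the identity. *)
Definition fold_mx A : 'M[C]_n := - (E *m (A *m j) *m adj E).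

(** The second block is [adj U] because the result has to be skew-Hermitian. *)
Definition unfold_mx U : 'M[C]_N :=
  unfold_corner e (adj E *m U *m E) (adj E *m adj U *m E).

Let unfold_cornerE (x y : 'M[C]_N) :
  unfold_corner e x y = spread e x *m j + j *m spread e y.
Proof. by []. Qed.

Let corner_mx U : corner h e (adj E *m U *m E).
Proof.
split; first by rewrite -Ep -[LHS]/(_ *m _) !mulmxA -(mulmxA _ E) EE mulmx1.
by rewrite -Ep -[LHS]/(_ *m _) !mulmxA -(mulmxA _ E) EE mulmx1.
Qed.

Let adj_spread (x : 'M[C]_N) : adj (spread e x) = spread e (adj x).
Proof.
apply: (star_spread e_sqr e_anti (@adjD _ _ _) (@adjM _ _ _ _) (@adj1 _ _)).
exact: e_adj.
Qed.

Let sandwich (q B : 'M[C]_N) : adj E *m E = q -> B *m q = q *m B -> q *m q = q ->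
  adj E *m (E *m B *m adj E) *m E = B *m q.
Proof.
move=> Eq Bq qq; rewrite !mulmxA Eq -(mulmxA (q *m B)) Eq -Bq.
by rewrite -mulmxA qq.
Qed.

Let frame_p : E *m p = E.
Proof. by rewrite -Ep mulmxA EE mul1mx. Qed.

Lemma fold_unfold U : fold_mx (unfold_mx U) = U.
Proof.
rewrite /fold_mx; set W := unfold_mx U.
have pW : p *m W *m j = - (adj E *m U *m E).
  exact: (prim_unfold_corner h2 h_central e_sqr e_anti).
clearbody W; have -> : E *m (W *m j) = E *m (p *m W *m j).
  by rewrite -(mulmxA p) (mulmxA E p) frame_p.
by rewrite pW mulmxN mulNmx opprK !mulmxA EE mul1mx -mulmxA EE mulmx1.
Qed.

Let adj_fold A : adj A = - A -> adj (fold_mx A) = - (E *m (j *m A) *m adj E).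
Proof.
move=> Aadj; have adj3 (X : 'M[C]_N) : adj (E *m X *m adj E) = E *m adj X *m adj E.
  by rewrite !adjM adjK mulmxA.
have -> : j *m A = adj (A *m j).
  by rewrite adjM Aadj (e_adj (isT : (7 < 8)%N)) mulNmx mulmxN opprK.
by rewrite -adj3 -adjN.
Qed.

Lemma unfold_fold_mx A : (forall i, (i < 7)%N -> A *m e i = - (e i *m A)) ->
  adj A = - A -> unfold_mx (fold_mx A) = A.
Proof.
move=> Ae Aadj; rewrite /unfold_mx.
have comm1 i : (i < 7)%N -> (A *m j) * e i = e i * (A *m j).
  exact: (mul_j_comm e_anti Ae).
have comm2 i : (i < 7)%N -> (j *m A) * e i = e i * (j *m A).
  exact: (j_mul_comm e_anti Ae).
have p1 : (A *m j) *m p = p *m (A *m j).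
  exact: (prim_comm_commutant h_central comm1).
have p2 : (j *m A) *m p = p *m (j *m A).
  exact: (prim_comm_commutant h_central comm2).
have pp : p *m p = p by exact: (prim_idem h2 h_central e_sqr e_anti).
have -> : adj E *m fold_mx A *m E = - (A *m j) *m p.
  by rewrite /fold_mx mulmxN mulNmx (sandwich Ep p1 pp) mulNmx.
have -> : adj E *m adj (fold_mx A) *m E = - (j *m A) *m p.
  have -> : adj (fold_mx A) = - (E *m (j *m A) *m adj E).
    exact: adj_fold.
  by rewrite mulmxN mulNmx (sandwich Ep p2 pp) mulNmx.
exact: (unfold_fold h2 h_central e_sqr e_anti Ae).
Qed.

Lemma adj_unfold_mx U : adj (unfold_mx U) = - unfold_mx U.
Proof.
set x := adj E *m U *m E; set y := adj E *m adj U *m E.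
have xy : adj x = y by rewrite /x !adjM adjK mulmxA.
have yx : adj y = x by rewrite /y !adjM !adjK mulmxA.
rewrite /unfold_mx -/x -/y unfold_cornerE.
have := adj_spread x; have := adj_spread y; rewrite xy yx.
move: (spread e x) (spread e y) => X Y YX XY.
by rewrite adjD !adjM XY YX e_adj // mulmxN mulNmx opprD addrC.
Qed.

Lemma unfold_mx_anti U i : (i < 7)%N ->
  unfold_mx U *m e i = - (e i *m unfold_mx U).
Proof.
move=> i7; apply: (unfold_corner_anti h_central e_sqr e_anti _ _ i7).
  exact: corner_mx.
exact: corner_mx.
Qed.

Let trace_spread_mx (x : 'M[C]_N) : \tr (spread e x) = \tr x *+ 8.
Proof.
exact: (trace_spread e_sqr e_anti (@mxtraceD _ _) (@mxtrace_mulC _ _ _)).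
Qed.

Let trace_unfold_corner (x x' y y' : 'M[C]_N) :
  corner h e x -> corner h e x' -> corner h e y -> corner h e y' ->
  \tr (unfold_corner e x x' *m unfold_corner e y y') =
  - ((\tr (x *m y') + \tr (x' *m y)) *+ 8).
Proof.
move=> cx cx' cy cy'.
have cross u v : corner h e u -> corner h e v ->
    spread e u *m (j *m spread e v) = 0.
  exact: (spread_j_spread h2 h_central e_sqr e_anti).
have spreadM u v : corner h e u -> corner h e v ->
    \tr (spread e u *m spread e v) = \tr (u *m v) *+ 8.
  move=> cu cv; rewrite -trace_spread_mx.
  by rewrite (spreadM h2 h_central e_sqr e_anti cu cv).
have z1 := cross _ _ cx cy; have z2 := cross _ _ cx' cy'.
have t1 := spreadM _ _ cx cy'; have t2 := spreadM _ _ cx' cy.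
rewrite !unfold_cornerE; move: z1 z2 t1 t2.
move: (spread e x) (spread e x') (spread e y) (spread e y') => X X' Y Y'.
move=> z1 z2 t1 t2; have jj : j *m j = - 1%:M by exact: e_sqr.
rewrite mulmxDl (mulmxDr (X *m j)) (mulmxDr (j *m X')) !mxtraceD.
have -> : X *m j *m (Y *m j) = 0 by rewrite -mulmxA (mulmxA j) (mulmxA X) z1 mul0mx.
have -> : j *m X' *m (j *m Y') = 0 by rewrite -(mulmxA j) z2 mulmx0.
have -> : X *m j *m (j *m Y') = - (X *m Y').
  by rewrite mulmxA -(mulmxA X) jj mulmxN mulmx1 mulNmx.
have -> : \tr (j *m X' *m (Y *m j)) = - \tr (X' *m Y).
  rewrite -(mulmxA j) mxtrace_mulC -!mulmxA jj.
  by rewrite !mulmxN mulmx1 raddfN.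
by rewrite mxtrace0 add0r addr0 raddfN /= t1 t2 -opprD -mulrnDl.
Qed.

Lemma adj_real_scale (m k : nat) (a : R) (M : 'M[C]_(m, k)) :
  adj (a%:C%C *: M) = a%:C%C *: adj M.
Proof.
rewrite /adj linearZ /= map_mxZ /=; congr (_ *: _).
by apply: complex_eqP; rewrite ?cRe_conj ?cIm_conj //= oppr0.
Qed.

Lemma fold_mx_linear (c : C) A X :
  fold_mx (c *: A + X) = c *: fold_mx A + fold_mx X.
Proof.
rewrite /fold_mx mulmxDl mulmxDr mulmxDl opprD.
by rewrite -scalemxAl -scalemxAr -scalemxAl scalerN.
Qed.

Let spread1_linear (K : 'M[C]_N) (c : C) A X :
  spread1 K (c *: A + X) = c *: spread1 K A + spread1 K X.
Proof.
change (c *: A + X - K *m (c *: A + X) *m K =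
  c *: (A - K *m A *m K) + (X - K *m X *m K)).
by rewrite mulmxDr mulmxDl -scalemxAr -scalemxAl scalerBr opprD addrACA.
Qed.

Let spread_linear (c : C) A X :
  spread e (c *: A + X) = c *: spread e A + spread e X.
Proof.
pose L s := spread1_linear (word e s) c.
pose S s := spread1 (word e s).
apply: etrans (congr1 (S [:: 2; 6]%N \o S [:: 4; 6]%N) (L [:: 5; 6]%N A X)) _.
exact: etrans (congr1 (S [:: 2; 6]%N) (L [:: 4; 6]%N _ _)) (L [:: 2; 6]%N _ _).
Qed.

(** The scalar is real because [unfold_mx] involves both [U] and [adj U]. *)
Lemma unfold_mx_linear (a : R) U V :
  unfold_mx (a%:C%C *: U + V) = a%:C%C *: unfold_mx U + unfold_mx V.
Proof.
rewrite /unfold_mx adjD adj_real_scale.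
have frameZ (W W' : 'M[C]_n) : adj E *m (a%:C%C *: W + W') *m E =
    a%:C%C *: (adj E *m W *m E) + adj E *m W' *m E.
  by rewrite mulmxDr mulmxDl -scalemxAr -scalemxAl.
rewrite !frameZ !unfold_cornerE !spread_linear.
move: (spread e _) (spread e _) (spread e _) (spread e _) => X1 X2 X3 X4.
by rewrite mulmxDl mulmxDr -scalemxAl -scalemxAr scalerDr addrACA.
Qed.

(** Each of the two blocks contributes 8 times a trace on the corner. The two traces are conjugate,
    so the real part is 16 times that of [U *m adj V]. *)
Lemma trace_unfold_mx U V :
  \tr (unfold_mx U *m adj (unfold_mx V)) =
  (\tr (U *m adj V) + \tr (adj U *m V)) *+ 8.
Proof.
rewrite adj_unfold_mx mulmxN raddfN /= /unfold_mx trace_unfold_corner ?opprK.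
- congr (_ *+ 8); have frame (u v : 'M[C]_n) :
      \tr (adj E *m u *m E *m (adj E *m v *m E)) = \tr (u *m v).
    rewrite mxtrace_mulC !mulmxA -(mulmxA _ E) EE mulmx1 -!mulmxA mxtrace_mulC.
    by rewrite !mulmxA -(mulmxA _ E) EE mulmx1 mxtrace_mulC.
  by rewrite !frame.
- exact: corner_mx.
- exact: corner_mx.
- exact: corner_mx.
- exact: corner_mx.
Qed.

Lemma unfold_mx_sqr U : U \is unitarymx -> unfold_mx U *m unfold_mx U = - 1%:M.
Proof.
move=> UU; apply: (unfold_corner_sqr h2 h_central e_sqr e_anti).
- exact: corner_mx.
- exact: corner_mx.
- rewrite -Ep -[LHS]/(_ *m _) !mulmxA -(mulmxA _ E) EE mulmx1.
  by rewrite -(mulmxA _ U) unitary_mul_adj // mulmx1.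
- rewrite -Ep -[LHS]/(_ *m _) !mulmxA -(mulmxA _ E) EE mulmx1.
  by rewrite -(mulmxA _ (adj U)) unitary_adj_mul // mulmx1.
Qed.

Lemma unfold_mx_unitary U : U \is unitarymx -> unfold_mx U \is unitarymx.
Proof.
by move=> UU; apply/unitaryP; rewrite adj_unfold_mx mulmxN unfold_mx_sqr // opprK.
Qed.

(** In the product of [fold_mx A] with its adjoint, the middle factor [adj E *m E = p] commutes with
    [A *m j] and is absorbed by [E]; what remains is A j j A = 1. *)
Lemma fold_mx_unitary A : (forall i, (i < 7)%N -> A *m e i = - (e i *m A)) ->
  adj A = - A -> A *m A = - 1%:M -> fold_mx A \is unitarymx.
Proof.
move=> Ae Aadj AA; apply/unitaryP.
have comm1 i : (i < 7)%N -> (A *m j) * e i = e i * (A *m j).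
  exact: (mul_j_comm e_anti Ae).
have Ap : (A *m j) *m p = p *m (A *m j).
  exact: (prim_comm_commutant h_central comm1).
have Ep' := frame_p; have Epp := Ep; move: (p) Ap Ep' Epp => q Ap Eq qE.
have jj : j *m j = - 1%:M by exact: e_sqr.
have -> : adj (fold_mx A) = - (E *m (j *m A) *m adj E).
  exact: adj_fold.
rewrite /fold_mx mulNmx mulmxN opprK !mulmxA -(mulmxA _ (adj E)) qE.
rewrite -(mulmxA E A) -(mulmxA E (A *m j)) Ap (mulmxA E) Eq -!mulmxA.
rewrite (mulmxA j j) jj mulNmx mul1mx mulmxN (mulmxA A A) AA mulNmx mul1mx.
by rewrite opprK.
Qed.

End FoldUnfold.

(** * Real Clifford generators from the base points *)

Section RealClifford.
Variables (R : realType) (n : nat).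
Variables (J : nat -> 'M[R]_(16 * n)) (J8 : 'M[R]_(16 * n)).
Hypotheses (J_bott : forall k, (0 < k <= 7)%N -> real_bott J k (J k))
  (J8_bott : real_bott J 8 J8).

(** The chain fixes only J_1, ..., J_7; the eighth generator is a separately chosen point satisfying
    the relations of the eighth stage. *)
Definition clifford_gen (i : nat) : 'M[R]_(16 * n) :=
  if i == 7 then J8 else J i.+1.

Local Notation e := clifford_gen.
Local Notation h := ((2^-1)%:M : 'M[R]_(16 * n)).

Lemma clifford_gen_bott i : (i < 8)%N -> real_bott J i.+1 (e i).
Proof.
rewrite /clifford_gen; case: eqP => [-> //|/eqP i7 i8]; apply: J_bott.
by rewrite /= ltn_neqAle i7 -ltnS.
Qed.

Lemma clifford_gen_sqr i : (i < 8)%N -> e i *m e i = - 1%:M.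
Proof. by move=> /clifford_gen_bott[]. Qed.

Lemma clifford_gen_tr i : (i < 8)%N -> (e i)^T = - e i.
Proof.
move=> /clifford_gen_bott[[eO _] e2 _].
by rewrite -[LHS]mulmx1 -[1%:M]opprK -e2 mulmxN mulmxA (mulmx1C eO) mul1mx.
Qed.

Lemma clifford_gen_anti i k : (i < 8)%N -> (k < 8)%N -> i != k ->
  e i *m e k = - (e k *m e i).
Proof.
have anti a b : (a < b)%N -> (b < 8)%N -> e b *m e a = - (e a *m e b).
  move=> ab b8; have [_ _] := clifford_gen_bott b8.
  have -> : e a = J a.+1.
    by rewrite /clifford_gen ltn_eqF // (leq_trans ab).
  by apply; rewrite ltnS.
move=> i8 k8; rewrite neq_ltn => /orP[ik|ki]; last exact: anti.
by rewrite (anti i k) // opprK.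
Qed.

Let h_central (x : 'M[R]_(16 * n)) : h *m x = x *m h.
Proof. by rewrite mul_scalar_mx mul_mx_scalar. Qed.

(** The frame has [n] rows because 16 times the trace of [prim] is the trace [16 * n] of the
    identity. *)
Lemma clifford_frame : exists E : 'M[R]_(n, 16 * n),
  E *m E^T = 1%:M /\ E^T *m E = prim h e.
Proof.
apply: orthonormal_frame.
- apply: (@star_prim _ h e h_central clifford_gen_sqr clifford_gen_anti trmx).
  + by move=> x y; rewrite linearD.
  + by move=> x y; rewrite trmx_mul.
  + exact: trmx1.
  + exact: tr_scalar_mx.
  + exact: clifford_gen_tr.
- exact: (prim_idem (half_scalar_mx _ _) h_central clifford_gen_sqr clifford_gen_anti).
- have := trace_prim (half_scalar_mx R (16 * n)) h_central clifford_gen_sqr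
    clifford_gen_anti (@mxtraceD _ _) (@mxtrace_mulC _ _ _).
  rewrite -[1]/(1%:M) mxtrace1; move: (\tr (prim h e)) => t.
  rewrite mulnC natrM mulr_natr -[n%:R *+ _]mulr_natr -[t *+ _]mulr_natr.
  by move=> /mulIf-> //; rewrite pnatr_eq0.
Qed.

End RealClifford.

(** * The correspondence between Q_8 and the unitary group *)

Section Isometry.
Variables (R : realType) (n : nat).
Variables (J : nat -> 'M[R]_(16 * n)) (J8 : 'M[R]_(16 * n)).
Hypotheses (J_bott : forall k, (0 < k <= 7)%N -> real_bott J k (J k))
  (J8_bott : real_bott J 8 J8).
Variable E : 'M[R]_(n, 16 * n).
Local Notation e := (clifford_gen J J8).
Hypotheses (E_orth : E *m E^T = 1%:M) (E_prim : E^T *m E = prim (2^-1)%:M e).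

Local Notation toCmx := (map_mx (real_complex R)).
Let Jc i : 'M[R[i]]_(16 * n) := toC (emb (J i)).
Let eC i : 'M[R[i]]_(16 * n) := toCmx (e i).
Let EC : 'M[R[i]]_(n, 16 * n) := toCmx E.

Lemma adj_real m p (A : 'M[R]_(m, p)) : adj (toCmx A) = toCmx A^T.
Proof.
apply/matrixP => i k; rewrite !mxE; apply: complex_eqP.
  exact: cRe_conj.
by apply: etrans (cIm_conj _) _; rewrite /= oppr0.
Qed.

Lemma ofC_real m (A : 'M[R]_m) : ofC (toCmx A) = emb A.
Proof. by apply: toC_inj; rewrite ofCK toC_emb. Qed.

Let eC_sqr i : (i < 8)%N -> eC i *m eC i = - 1%:M.
Proof.
by move=> i8; rewrite -map_mxM (clifford_gen_sqr J_bott J8_bott i8) map_mxN map_mx1.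
Qed.

Let eC_anti i k : (i < 8)%N -> (k < 8)%N -> i != k ->
  eC i *m eC k = - (eC k *m eC i).
Proof.
move=> i8 k8 ik; rewrite -!map_mxM -map_mxN.
by rewrite (clifford_gen_anti J_bott J8_bott i8 k8 ik).
Qed.

Let eC_adj i : (i < 8)%N -> adj (eC i) = - eC i.
Proof.
by move=> i8; rewrite adj_real (clifford_gen_tr J_bott J8_bott i8) map_mxN.
Qed.

Let EC_orth : EC *m adj EC = 1%:M.
Proof. by rewrite adj_real -map_mxM E_orth map_mx1. Qed.

Let EC_prim : adj EC *m EC = prim (2^-1)%:M eC.
Proof.
rewrite adj_real -map_mxM E_prim.
have -> : (2^-1)%:M = toCmx (2^-1)%:M :> 'M[R[i]]_(16 * n).
  by rewrite map_scalar_mx /= fmorphV rmorph_nat.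
apply: (@morph_prim _ _ toCmx).
- by move=> x y; exact: map_mxD.
- by move=> x y; exact: map_mxM.
- exact: map_mx1.
Qed.

Definition bott_to_unitary (z : cmat R (16 * n)) : cmat R n :=
  ofC (fold_mx eC EC (toC z)).

Definition unitary_to_bott (u : cmat R n) : cmat R (16 * n) :=
  ofC (unfold_mx eC EC (toC u)).

Local Notation psi := bott_to_unitary.
Local Notation psi' := unitary_to_bott.

Lemma toC_bott_to_unitary z : toC (psi z) = fold_mx eC EC (toC z).
Proof. exact: ofCK. Qed.

Lemma toC_unitary_to_bott u : toC (psi' u) = unfold_mx eC EC (toC u).
Proof. exact: ofCK. Qed.

Lemma bott8P (z : cmat R (16 * n)) : bott Jc 8 z <->
  [/\ toC z \is unitarymx, toC z *m toC z = - 1%:M &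
      forall i, (i < 7)%N -> toC z *m eC i = - (eC i *m toC z)].
Proof.
have eJ i : (i < 7)%N -> eC i = Jc i.+1.
  by move=> i7; rewrite /eC /Jc toC_emb /clifford_gen ltn_eqF.
split=> -[zU z2 zJ].
  split; [exact: zU | exact: z2 | move=> i i7].
  by rewrite (eJ i i7); exact: zJ.
split; [exact: zU | by move=> _ | case=> [//|i] i7].
by rewrite -(eJ i i7); exact: zJ.
Qed.

Lemma bott_adj z : bott Jc 8 z -> adj (toC z) = - toC z.
Proof. by move=> [zU /(_ isT) z2 _]; exact: square_oppr1_adj. Qed.

Lemma bott_to_unitary_in z : bott Jc 8 z -> Ugrp R n (psi z).
Proof.
move=> zQ; have zadj := bott_adj zQ; have [_ z2 ze] := (bott8P z).1 zQ.
rewrite /Ugrp /= toC_bott_to_unitary.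
exact: (fold_mx_unitary eC_sqr eC_anti eC_adj EC_orth EC_prim ze zadj z2).
Qed.

Lemma unitary_to_bott_in u : Ugrp R n u -> bott Jc 8 (psi' u).
Proof.
move=> uU; apply/bott8P; rewrite toC_unitary_to_bott; split.
- exact: (unfold_mx_unitary eC_sqr eC_anti eC_adj EC_orth EC_prim uU).
- exact: (unfold_mx_sqr eC_sqr eC_anti EC_orth EC_prim uU).
- by move=> i; exact: (unfold_mx_anti eC_sqr eC_anti EC_orth EC_prim).
Qed.

Lemma unitary_to_bottK u : psi (psi' u) = u.
Proof.
by rewrite /psi toC_unitary_to_bott (fold_unfold eC_sqr eC_anti EC_orth EC_prim) toCK.
Qed.

(** Only linear conditions on [z] appear, so the inversion formula applies to velocities as well as
    to points. *)
Lemma bott_to_unitaryK_gen z :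
  (forall i, (i < 7)%N -> toC z *m eC i = - (eC i *m toC z)) ->
  adj (toC z) = - toC z -> psi' (psi z) = z.
Proof.
move=> ze zadj; rewrite /psi' toC_bott_to_unitary.
by rewrite (unfold_fold_mx eC_sqr eC_anti eC_adj EC_prim ze zadj) toCK.
Qed.

Lemma bott_to_unitaryK z : bott Jc 8 z -> psi' (psi z) = z.
Proof.
move=> zQ; apply: bott_to_unitaryK_gen; last exact: bott_adj.
by have [_ _] := (bott8P z).1 zQ.
Qed.

Let dot_unfold (U V : 'M[R[i]]_n) :
  complex.Re (\tr (unfold_mx eC EC U *m adj (unfold_mx eC EC V))) =
  16 * complex.Re (\tr (U *m adj V)).
Proof.
rewrite (trace_unfold_mx eC_sqr eC_anti eC_adj EC_orth EC_prim).
have -> : \tr (adj U *m V) = \tr (adj (adj V *m U)) by rewrite adjM adjK.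
have ReMn (x : R[i]) k : complex.Re (x *+ k) = complex.Re x *+ k.
  by elim: k => // k IHk; rewrite !mulrS cReD IHk.
rewrite ReMn cReD trace_adj (mxtrace_mulC (adj V)).
by rewrite -mulr2n -mulrnA mulr_natl.
Qed.

Lemma dotmx_unitary_to_bott u v :
  Defs.dotmx (psi' u) (psi' v) = 16 * Defs.dotmx u v.
Proof.
apply: etrans (dotmx_trace _ _) _.
apply: etrans _ (congr1 ( *%R 16) (esym (dotmx_trace u v))).
apply: etrans (dot_unfold _ _).
exact: (congr2 (fun A B => complex.Re (\tr (A *m adj B)))
  (toC_unitary_to_bott u) (toC_unitary_to_bott v)).
Qed.

Lemma bott_to_unitary_linear : linear psi.
Proof.
move=> a x y; rewrite /psi toCD toCZ (fold_mx_linear eC EC).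
by rewrite ofCD ofCZ.
Qed.

Lemma unitary_to_bott_linear : linear psi'.
Proof.
move=> a x y; rewrite /psi' toCD toCZ (unfold_mx_linear eC EC).
by rewrite ofCD ofCZ.
Qed.

Definition real_fold (A : 'M[R]_(16 * n)) : 'M[R]_n := - (E *m (A *m J8) *m E^T).

Definition real_unfold (B : 'M[R]_n) : 'M[R]_(16 * n) :=
  unfold_corner e (E^T *m B *m E) (E^T *m B^T *m E).

Lemma bott_to_unitary_emb A : psi (emb A) = emb (real_fold A).
Proof.
apply: etrans _ (ofC_real _); rewrite /psi; congr ofC; rewrite toC_emb /fold_mx adj_real.
by rewrite /real_fold -!map_mxM -map_mxN.
Qed.

Lemma unitary_to_bott_emb B : psi' (emb B) = emb (real_unfold B).
Proof.
apply: etrans _ (ofC_real _); rewrite /psi'; congr ofC.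
rewrite toC_emb /unfold_mx !adj_real /real_unfold.
rewrite (@morph_unfold_corner _ _ toCmx).
- by rewrite !map_mxM.
- by move=> x y; exact: map_mxD.
- by move=> x y; exact: map_mxM.
- exact: map_mx1.
Qed.

End Isometry.
(** * The eighth term *)

(** Supplies the skewness hypothesis of [biinv_dotmx], through which both metrics are compared as
    Euclidean products. *)
Lemma unitary_velocity_skew (R : realType) (N : nat) (b : R -> cmat R N) (t : R) :
  (forall s, Ugrp R N (b s)) -> derivable b t 1 ->
  (invmx (toC (b t)) *m toC (derive1 b t))^t* =
  - (invmx (toC (b t)) *m toC (derive1 b t)).
Proof.
move=> bU db; rewrite (unitary_invmx (bU t)) -/(adj _) adjM adjK.
have dG := is_mxderive_toC db.
have d1 := is_mxderiveM (is_mxderive_adj dG) dG.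
have d0 : is_mxderive (fun s => adj (toC (b s)) *m toC (b s)) t 0.
  rewrite (_ : (fun s => _) = fun=> 1%:M); first exact: is_mxderive_cst.
  by apply: funext => s; apply: unitary_adj_mul; exact: bU.
by have /eqP := is_mxderive_unique d1 d0; rewrite addr_eq0 => /eqP.
Qed.

Section EighthTerm.
Variables (R : realType) (n : nat).
Variables (J : nat -> 'M[R]_(16 * n)) (J8 : 'M[R]_(16 * n)).
Hypotheses (J_bott : forall k, (0 < k <= 7)%N -> real_bott J k (J k))
  (J8_bott : real_bott J 8 J8).
Variable E : 'M[R]_(n, 16 * n).
Hypotheses (E_orth : E *m E^T = 1%:M)
  (E_prim : E^T *m E = prim (2^-1)%:M (clifford_gen J J8)).

Let Jc i : 'M[R[i]]_(16 * n) := toC (emb (J i)).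
Local Notation psi := (bott_to_unitary J J8 E).
Local Notation psi' := (unitary_to_bott J J8 E).

Let psi_cont : continuous psi.
Proof. exact/linear_cmat_continuous/bott_to_unitary_linear. Qed.

Let psi'_cont : continuous psi'.
Proof. exact/linear_cmat_continuous/unitary_to_bott_linear. Qed.

Let psi_smooth : smooth_on_open setT psi.
Proof.
exact: (@smooth_linear R _ _ psi (@bott_to_unitary_linear R n J J8 E) psi_cont setT).
Qed.

Let psi'_smooth : smooth_on_open setT psi'.
Proof.
exact: (@smooth_linear R _ _ psi' (@unitary_to_bott_linear R n J J8 E) psi'_cont setT).
Qed.

Lemma bott_velocity_unfold (a : R -> cmat R (16 * n)) (t : R) :
  (forall s, bott Jc 8 (a s)) -> derivable a t 1 ->
  psi' (psi (derive1 a t)) = derive1 a t.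
Proof.
move=> aQ da; have dA := is_mxderive_toC da.
apply: (bott_to_unitaryK_gen J_bott J8_bott E_prim) => [i i7|].
  have aJ s : toC (a s) *m map_mx (real_complex R) (clifford_gen J J8 i) =
      - (map_mx (real_complex R) (clifford_gen J J8 i) *m toC (a s)).
    by have [_ _] := (bott8P J J8 (a s)).1 (aQ s); exact.
  apply: (is_mxderive_unique (is_mxderiveMl _ dA)).
  rewrite (funext aJ); exact: is_mxderiveN (is_mxderiveMr _ dA).
apply: (is_mxderive_unique (is_mxderive_adj dA)).
rewrite (_ : (fun s => adj (toC (a s))) = (fun s => - toC (a s))).
  exact: is_mxderiveN.
by apply: funext => s; exact: bott_adj (aQ s).
Qed.

Lemma bott_to_unitary_isometry :
  riem_isometry (biinv 1) (biinv 16) (bott Jc 8) (Ugrp R n) psi.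
Proof.
have psiK z : bott Jc 8 z -> psi' (psi z) = z.
  exact: (bott_to_unitaryK J_bott J8_bott E_prim).
have psi'K u : psi (psi' u) = u.
  exact: (unitary_to_bottK J_bott J8_bott E_orth E_prim).
have psi_in z : bott Jc 8 z -> Ugrp R n (psi z).
  exact: (bott_to_unitary_in J_bott J8_bott E_orth E_prim).
have psi'_in u : Ugrp R n u -> bott Jc 8 (psi' u).
  exact: (unitary_to_bott_in J_bott J8_bott E_orth E_prim).
split.
- split; first exact: psi_in.
    by move=> x y /set_mem xQ /set_mem yQ xy; rewrite -(psiK _ xQ) xy psiK.
  by move=> u uU; exists (psi' u); [exact: psi'_in | exact: psi'K].
- move=> x xQ; exists setT, psi.
  split; [exact: openT | exact: I | exact: psi_smooth | by move=> y _ _].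
- exists psi'; last exact: psiK.
  move=> u uU; exists setT, psi'.
  split; [exact: openT | exact: I | exact: psi'_smooth | by move=> y _ _].
move=> x a b [aQ /(_ 0%N 0) da] [bQ /(_ 0%N 0) db] a0 b0.
have psi_derive (c : R -> cmat R (16 * n)) : derivable c 0 1 ->
    is_derive (0 : R) 1 (psi \o c) (psi (derive1 c 0)).
  move=> dc; exact: (@is_derive_linear R _ _ psi
    (@bott_to_unitary_linear R n J J8 E) psi_cont c 0 _ (derivable_is_derive1 dc)).
have db' := psi_derive b db; have psib := is_derive1_eq db'.
have psia := is_derive1_eq (psi_derive a da).
have skew1 : (invmx (toC x) *m toC (derive1 b 0))^t* =
    - (invmx (toC x) *m toC (derive1 b 0)).
  rewrite -b0; apply: unitary_velocity_skew db => s.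
  exact: bott_sub_unitary (bQ s).
have skew2 : (invmx (toC (psi x)) *m toC (derive1 (psi \o b) 0))^t* =
    - (invmx (toC (psi x)) *m toC (derive1 (psi \o b) 0)).
  rewrite -b0; apply: (@unitary_velocity_skew _ _ (psi \o b) 0).
    by move=> s; apply: psi_in; exact: bQ.
  by case: db'.
have xQ : bott Jc 8 x by rewrite -a0; exact: aQ.
apply: etrans (biinv_dotmx _ _ (psi_in _ xQ) skew2) _.
apply: etrans _ (esym (biinv_dotmx _ _ (bott_sub_unitary xQ) skew1)).
rewrite mul1r; apply: etrans (congr1 _ (congr2 (@Defs.dotmx R _) psia psib)) _.
(* The scaling by 16 is known for the inverse map; it transfers because unfolding the folded
   velocities gives them back. *)
apply: etrans (esym (dotmx_unitary_to_bott J_bott J8_bott E_orth E_prim _ _)) _.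
exact: (congr2 (@Defs.dotmx R _) (bott_velocity_unfold aQ da)
  (bott_velocity_unfold bQ db)).
Qed.

Lemma bott8_connected : connected (bott Jc 8).
Proof.
have -> : bott Jc 8 = psi' @` Ugrp R n.
  apply/seteqP; split=> [z zQ|_ [u uU <-]].
    exists (psi z).
      exact: (bott_to_unitary_in J_bott J8_bott E_orth E_prim).
    exact: (bott_to_unitaryK J_bott J8_bott E_prim).
  exact: (unitary_to_bott_in J_bott J8_bott E_orth E_prim).
apply: connected_continuous_connected; first exact: unitary_connected.
exact: continuous_subspaceT.
Qed.

Lemma real_bott_emb (A : 'M[R]_(16 * n)) : real_bott J 8 A -> bott Jc 8 (emb A).
Proof.
move=> [[AO _] A2 AJ]; rewrite /bott /= toC_emb; split.
- by apply/unitaryP; rewrite adj_real -map_mxM AO map_mx1.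
- by move=> _; rewrite -map_mxM A2 map_mxN map_mx1.
- by move=> i i8; rewrite /Jc toC_emb -!map_mxM AJ // map_mxN.
Qed.

(** Unitarity of the complexified matrix leaves the determinant 1 or -1, so the sign has to be
    supplied. *)
Lemma emb_real_bott (A : 'M[R]_(16 * n)) :
  bott Jc 8 (emb A) -> \det A = 1 -> real_bott J 8 A.
Proof.
have toR_inj := @map_mx_inj _ _ (real_complex R).
rewrite /bott /= toC_emb => -[/unitaryP AU A2 AJ] detA; split.
- split=> //; apply: toR_inj.
  by rewrite map_mxM -adj_real AU map_mx1.
- by apply: toR_inj; rewrite map_mxM A2 // map_mxN map_mx1.
- move=> i i8; apply: toR_inj; rewrite map_mxN !map_mxM.
  by have := AJ i i8; rewrite /Jc toC_emb.
Qed.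

Lemma Ugrp_emb (B : 'M[R]_n) : Ugrp R n (emb B) <-> orthogonal B.
Proof.
have toR_inj := @map_mx_inj _ _ (real_complex R).
rewrite /Ugrp /orthogonal /= toC_emb; split=> [/unitaryP BU|BO].
  by apply: toR_inj; rewrite map_mxM -adj_real BU map_mx1.
by apply/unitaryP; rewrite adj_real -map_mxM BO map_mx1.
Qed.

Lemma emb_inj m : injective (@emb R m).
Proof. by move=> A B []. Qed.

Lemma real_fold_J8 : real_fold J8 E J8 = 1%:M.
Proof.
have [_ J82 _] := J8_bott.
by rewrite /real_fold J82 mulmxN mulmx1 mulNmx opprK E_orth.
Qed.

Lemma real_unfoldK B : real_fold J8 E (real_unfold J J8 E B) = B.
Proof.
apply: emb_inj; rewrite -(bott_to_unitary_emb J) -unitary_to_bott_emb.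
exact: (unitary_to_bottK J_bott J8_bott E_orth E_prim).
Qed.

Lemma real_foldK A : real_bott J 8 A -> real_unfold J J8 E (real_fold J8 E A) = A.
Proof.
move=> AQ; apply: emb_inj; rewrite -unitary_to_bott_emb -(bott_to_unitary_emb J).
exact: (bott_to_unitaryK J_bott J8_bott E_prim (real_bott_emb AQ)).
Qed.

Lemma real_fold_orthogonal A : real_bott J 8 A -> orthogonal (real_fold J8 E A).
Proof.
move=> AQ; apply/Ugrp_emb; rewrite -(bott_to_unitary_emb J).
exact: (bott_to_unitary_in J_bott J8_bott E_orth E_prim (real_bott_emb AQ)).
Qed.

Lemma bott_real_unfold B :
  orthogonal B -> bott Jc 8 (emb (real_unfold J J8 E B)).
Proof.
move=> /Ugrp_emb BU; rewrite -unitary_to_bott_emb.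
exact: (unitary_to_bott_in J_bott J8_bott E_orth E_prim BU).
Qed.

Lemma real_unfold_orthogonal B : orthogonal B -> orthogonal (real_unfold J J8 E B).
Proof.
move=> /bott_real_unfold [+ _ _]; rewrite toC_emb => /unitaryP BU.
apply: (@map_mx_inj _ _ (real_complex R)).
by rewrite map_mxM -adj_real BU map_mx1.
Qed.

Lemma real_fold_continuous : continuous (real_fold J8 E).
Proof.
apply: linear_mx_continuous => a x y; rewrite /real_fold.
rewrite mulmxDl mulmxDr mulmxDl opprD.
by rewrite -scalemxAl -scalemxAr -scalemxAl scalerN.
Qed.

Lemma real_unfold_continuous : continuous (real_unfold J J8 E).
Proof.
have emb_cont : continuous (@emb R n).
  apply: linear_mx_continuous => a x y.
  by congr pair; rewrite /= scaler0 addr0.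
have -> : real_unfold J J8 E = fst \o (psi' \o @emb R n).
  by apply: funext => B; rewrite -[RHS]/(psi' (emb B)).1 unitary_to_bott_emb.
move=> B; apply: (@continuous_comp _ _ _ (psi' \o @emb R n) fst).
  apply: (@continuous_comp _ _ _ (@emb R n) psi'); first exact: emb_cont.
  exact: psi'_cont.
exact: cvg_fst.
Qed.

(** Folding sends [J8] to the identity, so the connected image of the component keeps determinant 1.
    Conversely, unfolding SO_n gives a connected set through [J8], on which the determinant stays 1
    and which therefore lies in the component. *)
Lemma real_fold_component :
  connected (SO R n) ->
  real_fold J8 E @` connected_component (real_bott J 8) J8 = SO R n.
Proof.
move=> SOc; apply/seteqP; split.
  set C := connected_component _ _; have CQ : C `<=` real_bott J 8.
    exact: connected_component_sub.
  have foldC : connected (real_fold J8 E @` C).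
    apply: connected_continuous_connected; first exact: component_connected.
    by apply: continuous_subspaceT; exact: real_fold_continuous.
  have foldO : real_fold J8 E @` C `<=` @orthogonal R n.
    by move=> _ [A CA <-]; exact: real_fold_orthogonal (CQ _ CA).
  have CJ8 : (real_fold J8 E @` C) 1%:M.
    by exists J8; [exact: connected_component_refl | exact: real_fold_J8].
  move=> B CB; split; first exact: foldO CB.
  exact: (det_connected foldC foldO CJ8 CB (det1 _ _)).
move=> B BS; exists (real_unfold J J8 E B); last exact: real_unfoldK.
have unfoldC : connected (real_unfold J J8 E @` SO R n).
  apply: connected_continuous_connected SOc _.
  by apply: continuous_subspaceT; exact: real_unfold_continuous.
have unfoldO : real_unfold J J8 E @` SO R n `<=` @orthogonal R (16 * n).
  by move=> _ [A [AO _] <-]; exact: real_unfold_orthogonal.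
have CJ8 : (real_unfold J J8 E @` SO R n) J8.
  exists 1%:M; first by split; rewrite ?trmx1 ?mulmx1 ?det1.
  by rewrite -real_fold_J8 real_foldK.
have detJ8 : \det J8 = 1 by case: J8_bott => -[].
apply: (connected_component_max CJ8 _ unfoldC); last by exists B.
move=> A SA; have [M [MO _] ME] := SA; apply: emb_real_bott.
  by rewrite -ME; exact: bott_real_unfold.
exact: (det_connected unfoldC unfoldO CJ8 SA detJ8).
Qed.

End EighthTerm.
Theorem theorem4p1 (R : realType) (n : nat) (n_ge1 : (1 <= n)%N)
  (J : nat -> 'M[R]_(16 * n))
  (P : nat -> set 'M[R]_(16 * n))
  (Pt : nat -> set (cmat R (16 * n)))
  (hSO : SO_Bott_chain J P)
  (hU : U_Bott_chain J Pt) :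
  [set emb A | A in P 8%N] `<=` Pt 8%N /\
  exists psi : cmat R (16 * n) -> cmat R n,
    riem_isometry (biinv 1) (biinv 16) (Pt 8%N) (Ugrp R n) psi /\
    psi @` [set emb A | A in P 8%N] = [set emb A | A in SO R n].
Proof.
have J_bott k : (0 < k <= 7)%N -> real_bott J k (J k) by exact: (SO_chain_base hSO).
(* The eighth generator is the point whose component is [P 8], so the identity of SO_n will
   correspond to a point of [P 8]. *)
have [J8 J8_bott PE] : is_component (real_bott J 8) (P 8%N).
  by apply: SO_chain_component hSO _ _.
have [E [E_orth E_prim]] := clifford_frame J_bott J8_bott.
have PtE : Pt 8%N = bott (fun i => toC (emb (J i))) 8.
  have [z zQ ->] := U_chain_component hSO hU (leqnn 8).
  apply: connected_component_id => //.
  exact: (bott8_connected J_bott J8_bott E_orth E_prim).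
split.
  move=> _ [A PA <-]; rewrite PtE; apply: real_bott_emb.
  by move: PA; rewrite PE => /connected_component_sub.
exists (bott_to_unitary J J8 E); split.
  by rewrite PtE; exact: (bott_to_unitary_isometry J_bott J8_bott E_orth E_prim).
(* [n >= 1] enters here, connectedness being stated for size [n.+1]. *)
have SOc : connected (SO R n) by rewrite -(prednK n_ge1); exact: SO_connected.
rewrite -(real_fold_component J_bott J8_bott E_orth E_prim SOc) -PE.
apply/seteqP; split.
  move=> _ [_ [A PA <-] <-]; exists (real_fold J8 E A); first by exists A.
  by rewrite bott_to_unitary_emb.
move=> _ [_ [A PA <-] <-]; exists (emb A); first by exists A.
exact: bott_to_unitary_emb.
Qed.
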